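(* Let $G$ be a finitely generated torsionfree discrete countable group such that every non-zero element of $\mathbb Z G$ acts without kernel on $\ell^2 G$. Then $$e_S(G) \geq 2 \lceil \beta_1^{(2)}(G) \rceil +1$$ for any finite generating set $S$ of $G$.
   Context: $\mathbb Z G$ acts on the Hilbert space $\ell^2 G$ via the linear extension of the left regular representation; ''without kernel'' means injectively. The exponential growth rate is $e_S(G) = \lim_{n \to \infty} \sqrt[n]{\# B_S(e,n)}$, where $B_S(e,n)$ is the ball of radius $n$ around $e$ in the word metric associated with the generating set $S$ (words in elements of $S$ and their inverses). $\lceil x\rceil$ is the least integer $\ge x$. $\beta_1^{(2)}(G)=\dim_{LG}H_1(G;LG)$ is the first $\ell^2$-Betti number, where $LG$ is the group von Neumann algebra and $\dim_{LG}$ is Lück's dimension function. *)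

(* Defs.v *)
From HB Require Import structures.
From mathcomp Require Import all_boot all_order all_algebra.
From mathcomp Require Import finmap complex.
From mathcomp Require Import all_classical all_reals all_analysis.
From mathcomp Require Import ring lra.

Set Implicit Arguments.
Unset Strict Implicit.
Unset Printing Implicit Defensive.

Import Order.TTheory GRing.Theory Num.Theory.

Local Open Scope classical_set_scope.
Local Open Scope ring_scope.

Section FinSupp.
Context (A : pzRingType) (K : choiceType) (V : lmodType A).

Definition fin_supp : {pred K -> V} :=
  fun f => `[< finite_set [set k | f k != 0] >].

Lemma fin_supp_submod_closed : submod_closed fin_supp.
Proof.
split; first by apply/asboolP; apply: (sub_finite_set _ (finite_set0 K)) => k /=;
  rewrite eqxx.
move=> a f g /asboolP ff /asboolP fg; apply/asboolP.
have fU : finite_set ([set k | f k != 0] `|` [set k | g k != 0])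
  by rewrite finite_setU.
apply: sub_finite_set fU => k /= H.
have [f0|] := eqVneq (f k) 0; last by left.
right; apply: contraNN H => /eqP g0.
by apply/eqP; rewrite -[LHS]/(a *: f k + g k) f0 g0 scaler0 addr0.
Qed.

HB.instance Definition _ :=
  GRing.isSubmodClosed.Build A (K -> V) fin_supp fin_supp_submod_closed.

Record finsupp_fun := FinSuppFun {
  finsupp_val :> K -> V;
  _ : finsupp_val \in fin_supp }.

HB.instance Definition _ := [isSub for finsupp_val].
HB.instance Definition _ := [Choice of finsupp_fun by <:].
HB.instance Definition _ := [SubChoice_isSubZmodule of finsupp_fun by <:].
HB.instance Definition _ := [SubZmodule_isSubLmodule of finsupp_fun by <:].

Lemma finsupp_finite (c : finsupp_fun) : finite_set [set k | c k != 0].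
Proof. by case: c => c cf; exact/asboolP. Qed.

Lemma finsuppP (c d : finsupp_fun) : (forall k, c k = d k) -> c = d.
Proof. by move=> e; apply/val_inj/funext. Qed.

Lemma fs_single_subproof (k : K) (v : V) :
  (fun k' => if k' == k then v else 0) \in fin_supp.
Proof.
apply/asboolP; apply: (sub_finite_set _ (finite_set1 k)) => k' /=.
by case: (eqVneq k' k) => // _; rewrite eqxx.
Qed.

Definition fs_single k v : finsupp_fun := FinSuppFun (fs_single_subproof k v).

Lemma fs_single_is_linear k : linear (fs_single k).
Proof.
move=> a u v; apply: finsuppP => k'.
rewrite -[RHS]/(a *: fs_single k u k' + fs_single k v k') /=.
by case: (eqVneq k' k) => // _; rewrite scaler0 addr0.
Qed.

Definition fs_lift (W : zmodType) (F : K -> V -> W) (c : finsupp_fun) : W :=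
  \sum_(k \in [set: K]) F k (c k).

Lemma fs_lift_is_linear (W : lmodType A) (F : K -> V -> W) :
  (forall k, linear (F k)) -> linear (fs_lift F).
Proof.
move=> linF a c d; rewrite /fs_lift.
have F0 k : F k 0 = 0.
  by have := linF k (-1) 0 0; rewrite scaleN1r addr0 oppr0 scaleN1r addNr.
pose D := [set k | c k != 0] `|` [set k | d k != 0].
have fD : finite_set D by rewrite finite_setU; split; exact: finsupp_finite.
have toD (e : finsupp_fun) : [set k | e k != 0] `<=` D ->
    \sum_(k \in [set: K]) F k (e k) = \sum_(k \in D) F k (e k).
  move=> eD; apply/esym/fsbig_widen => // k [_ kD] /=.
  have [->|ek] := eqVneq (e k) 0; first exact: F0.
  by case: kD; exact: eD.
rewrite !toD //; [|by move=> k; right|by move=> k; left|].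
- rewrite !fsbig_finite //= scaler_sumr -big_split /=.
  by apply: eq_bigr => k _; rewrite -linF.
- move=> k; apply: contraPP => /not_orP /= [/negP/negPn/eqP c0 /negP/negPn/eqP d0].
  by apply/negP/negPn/eqP; rewrite -[LHS]/(a *: c k + d k) c0 d0 scaler0 addr0.
Qed.

Lemma fs_lift_single (W : zmodType) (F : K -> V -> W) k v :
  (forall k, F k 0 = 0) -> fs_lift F (fs_single k v) = F k v.
Proof.
move=> F0; rewrite /fs_lift.
rewrite -(fsbig_widen [set k]) ?fsbig_set1 /= ?eqxx // => k' [_ /= /eqP].
by move=> /negPf ->.
Qed.

Lemma fs_lift_comp (W W' : lmodType A) (f : W -> W') (F : K -> V -> W) c :
    linear f -> (forall k, F k 0 = 0) ->
  f (fs_lift F c) = fs_lift (fun k v => f (F k v)) c.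
Proof.
move=> linf F0.
have f0 : f 0 = 0.
  by have := linf (-1) 0 0; rewrite scaleN1r addr0 oppr0 scaleN1r addNr.
have fD : {morph f : x y / x + y}.
  by move=> x y; rewrite -{1}[x]scale1r linf scale1r.
rewrite /fs_lift; pose D := [set k | c k != 0].
have outD k : ([set: K] `\` D) k -> c k = 0.
  by move=> [_ /negP/negPn/eqP].
have toD (U : zmodType) (F' : K -> V -> U) : (forall k, F' k 0 = 0) ->
    \sum_(k \in [set: K]) F' k (c k) = \sum_(k \in D) F' k (c k).
  move=> F'0; apply/esym/fsbig_widen => // k kD.
  by rewrite /preimage /= (outD k kD) F'0.
rewrite (toD W F F0) (toD W' (fun k v => f (F k v))); last first.
  by move=> k; rewrite F0.
have fD' : finite_set D by exact: finsupp_finite.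
rewrite !(fsbig_finite _ _ fD') /=.
exact: (big_morph f fD f0).
Qed.

End FinSupp.

Section QuotLmod.
Context (A : pzRingType) (M : lmodType A) (N : submodClosed M).

Local Open Scope quotient_scope.

(** [submodClosed] does not coerce to [zmodClosed], which [Quotient.quot]
    expects. *)
Definition submod_pred : {pred M} := N.
HB.instance Definition _ :=
  GRing.isSubmodClosed.Build A M submod_pred (submodClosedP N).

Definition quot_lmod : Type := Quotient.quot submod_pred.

HB.instance Definition _ := GRing.Zmodule.on quot_lmod.

Definition quot_pi (x : M) : quot_lmod := \pi_(Quotient.quot submod_pred) x.

Definition quot_scale (a : A) (x : quot_lmod) : quot_lmod :=
  quot_pi (a *: repr (x : Quotient.quot submod_pred)).

Lemma quot_piE x y : (quot_pi x = quot_pi y) <-> (x - y \in N).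
Proof.
have -> : (x - y \in N) = (x - y \in submod_pred) by [].
rewrite Quotient.idealrBE.
by split=> [e|/eqP]; first exact/eqP.
Qed.

Lemma quot_piD : {morph quot_pi : x y / x + y}.
Proof. by move=> x y; apply: Quotient.pi_add. Qed.

Lemma quot_piK (x : quot_lmod) :
  quot_pi (repr (x : Quotient.quot submod_pred)) = x.
Proof. exact: reprK. Qed.

Lemma quot_piZ a x : quot_scale a (quot_pi x) = quot_pi (a *: x).
Proof.
apply/quot_piE; rewrite -scalerBr rpredZ //.
by apply/quot_piE; rewrite quot_piK.
Qed.

Fact quot_scaleA a b v : quot_scale a (quot_scale b v) = quot_scale (a * b) v.
Proof. by rewrite -[v]quot_piK !quot_piZ scalerA. Qed.
Fact quot_scale1 : left_id 1 quot_scale.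
Proof. by move=> v; rewrite -[v]quot_piK quot_piZ scale1r. Qed.
Fact quot_scaleDr : right_distributive quot_scale +%R.
Proof.
move=> a u v; rewrite -[u]quot_piK -[v]quot_piK.
by rewrite -quot_piD !quot_piZ -quot_piD scalerDr.
Qed.
Fact quot_scaleDl v : {morph quot_scale^~ v : a b / a + b}.
Proof.
by move=> a b; rewrite -[v]quot_piK !quot_piZ -quot_piD scalerDl.
Qed.

HB.instance Definition _ := GRing.Zmodule_isLmodule.Build A quot_lmod
  quot_scaleA quot_scale1 quot_scaleDr quot_scaleDl.

End QuotLmod.

Section L2.
Context (R : realType) (K : choiceType).
Local Notation C := R[i].

Definition sqnormc (z : C) : R := complex.Re z ^+ 2 + complex.Im z ^+ 2.

Lemma sqnormc_ge0 z : 0 <= sqnormc z.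
Proof. by rewrite addr_ge0 ?sqr_ge0. Qed.

Lemma sqnormcM z w : sqnormc (z * w) = sqnormc z * sqnormc w.
Proof. by case: z w => [a b] [c d]; rewrite /sqnormc /=; ring. Qed.

Lemma sqnormcD z w : sqnormc (z + w) <= 2 * sqnormc z + 2 * sqnormc w.
Proof.
case: z w => [a b] [c d]; rewrite /sqnormc /=.
by have := sqr_ge0 (a - c); have := sqr_ge0 (b - d); nra.
Qed.

Definition l2sum (f : K -> C^o) : \bar R :=
  \esum_(k in [set: K]) (sqnormc (f k))%:E.

Lemma l2sum_ge0 f : (0 <= l2sum f)%E.
Proof. by apply: esum_ge0 => k _; rewrite lee_fin sqnormc_ge0. Qed.

Lemma l2sumZ (a : R) (h : K -> R) : 0 <= a -> (forall k, 0 <= h k) ->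
  (\esum_(k in [set: K]) (a * h k)%:E <= a%:E * \esum_(k in [set: K]) (h k)%:E)%E.
Proof.
move=> a0 h0; apply: ge_ereal_sup => _ [X [fX _] <-].
rewrite (eq_fsbigr (fun k => (a%:E * (h k)%:E)%E)); last by [].
rewrite fsbig_finite //= -ge0_sume_distrr; last by move=> k _; rewrite lee_fin.
apply: lee_pmul => //; first by apply: sume_ge0 => k _; rewrite lee_fin.
apply: ereal_sup_ubound; exists X => //.
by rewrite fsbig_finite.
Qed.

Lemma l2sumD (f g : K -> C^o) : (l2sum (f + g)%R <= 2%:E * l2sum f + 2%:E * l2sum g)%E.
Proof.
apply: (@le_trans _ _ (\esum_(k in [set: K])
   ((2 * sqnormc (f k))%:E + (2 * sqnormc (g k))%:E))%E).
  by apply: le_esum => k _; rewrite -EFinD lee_fin sqnormcD.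
rewrite esumD; last 2 first.
- by move=> k _; rewrite lee_fin mulr_ge0 ?sqnormc_ge0.
- by move=> k _; rewrite lee_fin mulr_ge0 ?sqnormc_ge0.
by apply: leeD; apply: l2sumZ => // k; exact: sqnormc_ge0.
Qed.

Lemma l2sum_scale (a : C) (f : K -> C^o) : (l2sum (a *: f)%R <= (sqnormc a)%:E * l2sum f)%E.
Proof.
apply: le_trans (l2sumZ _ _); last 2 first.
- exact: sqnormc_ge0.
- by move=> k; exact: sqnormc_ge0.
by apply: le_esum => k _; rewrite lee_fin -sqnormcM.
Qed.

Definition l2_pred : {pred K -> C^o} := fun f => `[< (l2sum f < +oo)%E >].

Lemma l2_submod_closed : submod_closed l2_pred.
Proof.
split.
  apply/asboolP; rewrite /l2sum esum1 ?ltry // => k _.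
  by rewrite /sqnormc /= expr0n addr0.
move=> a f g /asboolP ff /asboolP fg; apply/asboolP.
have fin (t : R) (h : K -> C^o) : (l2sum h < +oo)%E -> 0 <= t ->
    (t%:E * l2sum h < +oo)%E.
  move=> hh t0; have : l2sum h \is a fin_num by rewrite ge0_fin_numE ?l2sum_ge0.
  by case: (l2sum h) => // r _; rewrite -EFinM ltry.
apply: le_lt_trans (l2sumD (a *: f) g) _.
apply: lte_add_pinfty; apply: (fin) => //.
exact: le_lt_trans (l2sum_scale a f) (fin _ _ ff (sqnormc_ge0 a)).
Qed.

HB.instance Definition _ :=
  GRing.isSubmodClosed.Build C (K -> C^o) l2_pred l2_submod_closed.

Record l2 := L2Fun { l2_val :> K -> C^o; _ : l2_val \in l2_pred }.

HB.instance Definition _ := [isSub for l2_val].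
HB.instance Definition _ := [Choice of l2 by <:].
HB.instance Definition _ := [SubChoice_isSubZmodule of l2 by <:].
HB.instance Definition _ := [SubZmodule_isSubLmodule of l2 by <:].

Lemma l2P (x y : l2) : (forall k, x k = y k) -> x = y.
Proof. by move=> e; apply/val_inj/funext. Qed.

Definition l2norm (x : l2) : R := Num.sqrt (fine (l2sum x)).

Lemma l2norm_ge0 x : 0 <= l2norm x. Proof. exact: sqrtr_ge0. Qed.

Lemma l2sum_fin (x : l2) : l2sum x = (fine (l2sum x))%:E.
Proof.
by rewrite fineK // ge0_fin_numE ?l2sum_ge0 //; case: x => x /= /asboolP.
Qed.

Lemma l2norm_sqr x : l2norm x ^+ 2 = fine (l2sum x).
Proof. by rewrite sqr_sqrtr // fine_ge0 // l2sum_ge0. Qed.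

Lemma l2normD x y : l2norm (x + y) <= 2 * (l2norm x + l2norm y).
Proof.
rewrite -(@ler_pXn2r _ 2) ?nnegrE ?mulr_ge0 ?addr_ge0 ?l2norm_ge0 //.
have : l2norm (x + y) ^+ 2 <= 2 * l2norm x ^+ 2 + 2 * l2norm y ^+ 2.
  rewrite !l2norm_sqr -lee_fin EFinD !EFinM -!l2sum_fin.
  exact: (l2sumD x y).
move/le_trans; apply.
by have := l2norm_ge0 x; have := l2norm_ge0 y; nra.
Qed.

Lemma l2normN x : l2norm (- x) = l2norm x.
Proof.
rewrite /l2norm; congr (Num.sqrt (fine _)); apply: eq_esum => k _.
rewrite -[(- x) k]/(- (x k)) /sqnormc.
by case: (x k) => a b /=; rewrite !sqrrN.
Qed.

Lemma l2delta_subproof (k : K) :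
  (fun k' => if k' == k then 1 else 0 : C^o) \in l2_pred.
Proof.
apply/asboolP; rewrite /l2sum.
rewrite (esum_mkcond (R := R)).
have -> : \esum_(i in [set: K]) (if i \in [set: K] then
    (sqnormc (if i == k then 1 else 0))%:E else 0)%E
  = \esum_(i in [set k]) (1%:E : \bar R).
  rewrite [RHS]esum_mkcond; apply: eq_esum => i _.
  rewrite in_setT; case: eqP => [->|/eqP ik].
    by rewrite mem_set // /sqnormc /= expr1n expr0n addr0.
  rewrite memNset; last by move=> /= e; rewrite e eqxx in ik.
  by rewrite /sqnormc /= expr0n addr0.
by rewrite esum_set1 ?ltry // lee_fin.
Qed.

Definition l2delta k : l2 := L2Fun (l2delta_subproof k).

Definition bounded_op (T : l2 -> l2) : Prop :=
  linear T /\ exists M : R, forall x, l2norm (T x) <= M * l2norm x.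

End L2.

Section VonNeumann.
Context (R : realType) (G : groupType).
Local Notation H := (l2 R G).

Lemma lreg_l2sum (g : G) (x : G -> R[i]^o) :
  l2sum (fun h => x (g^-1 * h)%g) = l2sum x.
Proof.
rewrite /l2sum (@reindex_esum R G G setT setT (fun h => (g^-1 * h)%g)) //.
split=> //.
- by move=> h k _ _ /mulgI.
- by move=> h _; exists (g * h)%g => //; rewrite mulKg.
Qed.

Lemma lreg_subproof (g : G) (x : H) :
  (fun h => x (g^-1 * h)%g) \in l2_pred (R := R) (K := G).
Proof. by apply/asboolP; rewrite lreg_l2sum; case: x => x /= /asboolP. Qed.

Definition lreg (g : G) (x : H) : H := L2Fun (lreg_subproof g x).

Lemma lreg_linear g : linear (lreg g).
Proof. by move=> a x y; apply: l2P. Qed.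

Lemma lreg_norm g x : l2norm (lreg g x) = l2norm x.
Proof. by rewrite /l2norm lreg_l2sum. Qed.

Lemma lreg_bounded g : bounded_op (lreg g).
Proof.
by split; [exact: lreg_linear|exists 1 => x; rewrite lreg_norm mul1r].
Qed.

Definition lreg_commutant (S : H -> H) : Prop :=
  bounded_op S /\ forall g x, S (lreg g x) = lreg g (S x).

(** [LG] is the double commutant of the left regular representation in the
    bounded operators on [l^2 G]. *)
Definition LG_pred : {pred H -> H} := fun T =>
  `[< bounded_op T /\ forall S, lreg_commutant S -> forall x, T (S x) = S (T x) >].

Lemma LG_zmod_closed : zmod_closed LG_pred.
Proof.
split.
  apply/asboolP; split.
    split; first by move=> a x y; rewrite -[LHS]/(0 : H) scaler0 addr0.
    exists 0 => x; rewrite mul0r /l2norm.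
    rewrite (_ : l2sum _ = 0%E) ?sqrtr0 //.
    by apply: esum1 => k _; rewrite /sqnormc /= expr0n addr0.
  move=> S [[linS _] _] x; rewrite -[LHS]/(0 : H) -[X in S X]/(0 : H).
  by have := linS (-1) 0 0; rewrite scaleN1r addr0 oppr0 scaleN1r addNr.
move=> T U /asboolP [[linT [M bT]] cT] /asboolP [[linU [N bU]] cU].
apply/asboolP; split.
  split.
    move=> a x y; rewrite -[LHS]/(T (a *: x + y) - U (a *: x + y)).
    rewrite linT linU -[(T - U) x]/(T x - U x) -[(T - U) y]/(T y - U y).
    by rewrite scalerBr opprD addrACA.
  exists (2 * (M + N)) => x; apply: le_trans (l2normD (T x) (- U x)) _.
  by rewrite l2normN -mulrA ler_pM2l // mulrDl lerD.
move=> S [[linS bS] cS] x.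
rewrite -[LHS]/(T (S x) - U (S x)) cT // cU // -[(T - U) x]/(T x - U x).
by rewrite addrC -scaleN1r -linS scaleN1r addrC.
Qed.

HB.instance Definition _ :=
  GRing.isZmodClosed.Build (H -> H) LG_pred LG_zmod_closed.

Record LG := MkLG { LG_val :> H -> H; _ : LG_val \in LG_pred }.

HB.instance Definition _ := [isSub for LG_val].
HB.instance Definition _ := [Choice of LG by <:].
HB.instance Definition _ := [SubChoice_isSubZmodule of LG by <:].

Lemma LGP (S T : LG) : (forall x, S x = T x) -> S = T.
Proof. by move=> e; apply/val_inj/funext. Qed.

Lemma LG_linear (T : LG) : linear T.
Proof. by case: T => T /= /asboolP [[]]. Qed.

Fact LG_one_subproof : (fun x => x) \in LG_pred.
Proof.
by apply/asboolP; split=> //; split=> //; exists 1 => x; rewrite mul1r.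
Qed.
Definition LG_one : LG := MkLG LG_one_subproof.

Fact LG_mul_subproof (S T : LG) : (fun x => S (T x)) \in LG_pred.
Proof.
case: S T => [S pS] [T pT] /=.
move/asboolP: pS => [[linS [M bS]] cS]; move/asboolP: pT => [[linT [N bT]] cT].
apply/asboolP; split; last by move=> U cU x; rewrite cT // cS.
split; first by move=> a x y; rewrite linT linS.
exists (`|M| * `|N|) => x; apply: le_trans (bS _) _.
apply: (@le_trans _ _ (`|M| * l2norm (T x))).
  by rewrite ler_wpM2r ?l2norm_ge0 // ler_norm.
rewrite -mulrA ler_wpM2l //; apply: le_trans (bT _) _.
by rewrite ler_wpM2r ?l2norm_ge0 // ler_norm.
Qed.
Definition LG_mul (S T : LG) : LG := MkLG (LG_mul_subproof S T).

Fact LG_mulA : associative LG_mul. Proof. by move=> S T U; apply: LGP. Qed.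
Fact LG_mul1 : left_id LG_one LG_mul. Proof. by move=> S; apply: LGP. Qed.
Fact LG_mulr1 : right_id LG_one LG_mul. Proof. by move=> S; apply: LGP. Qed.
Fact LG_mulDl : left_distributive LG_mul +%R.
Proof. by move=> S T U; apply: LGP. Qed.
Fact LG_mulDr : right_distributive LG_mul +%R.
Proof.
move=> S T U; apply: LGP => x.
rewrite -[LHS]/(S (T x + U x)) -[RHS]/(S (T x) + S (U x)).
by have := LG_linear S 1 (T x) (U x); rewrite !scale1r.
Qed.

HB.instance Definition _ := GRing.Zmodule_isPzRing.Build LG
  LG_mulA LG_mul1 LG_mulr1 LG_mulDl LG_mulDr.

Fact LG_unit_subproof (g : G) : lreg g \in LG_pred.
Proof.
by apply/asboolP; split; [exact: lreg_bounded|move=> S [_ cS] x; rewrite cS].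
Qed.

Definition LGu (g : G) : LG := MkLG (LG_unit_subproof g).

Lemma LGuM g h : LGu (g * h)%g = LGu g * LGu h.
Proof. by apply: LGP => x; apply: l2P => k /=; rewrite invgM mulgA. Qed.

(** This is [<T delta_e, delta_e>]. *)
Definition LGtr (T : LG) : R[i] := T (l2delta R 1%g) 1%g.

(** A finitely generated projective (left) [LG]-module is, up to isomorphism,
    the row space [LG^n A] of an idempotent matrix [A], and its dimension is the
    trace of [A], which is a real number.  For an arbitrary module [M] the
    dimension is the supremum of the dimensions of the finitely generated
    projective submodules of [M], that is, of the row spaces [LG^n A] which
    embed in [M]. *)
Definition proj_embeds (M : lmodType LG) (n : nat) (A : 'M[LG]_n) : Prop :=
  exists f : {linear 'rV[LG]_n -> M},
    forall x y : 'rV[LG]_n, f (x *m A) = f (y *m A) -> x *m A = y *m A.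

Definition LGdim (M : lmodType LG) : \bar R :=
  ereal_sup [set d | exists n (A : 'M[LG]_n),
    [/\ A *m A = A, proj_embeds M A
      & d = (complex.Re (\sum_i LGtr (A i i)))%:E]].

(** Degrees 2, 1, 0 of [LG (x)_{ZG} B], where [B] is the (inhomogeneous) bar
    resolution of the trivial module [Z]; [fs_single k a] is [a (x) [k]]. *)
Definition chains0 := (LG : pzRingType)^o.
Definition chains1 := finsupp_fun G chains0.
Definition chains2 := finsupp_fun (G * G)%type chains0.

Definition bd1 : chains1 -> chains0 :=
  fs_lift (fun g (a : chains0) => (a : LG) * LGu g - a).

Definition bd2 : chains2 -> chains1 :=
  fs_lift (fun (p : G * G) (a : chains0) =>
    fs_single p.2 ((a : LG) * LGu p.1 : chains0)
    - fs_single (p.1 * p.2)%g a + fs_single p.1 a).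

Lemma bd1_linear : linear bd1.
Proof.
apply: fs_lift_is_linear => g a x y.
rewrite -[LHS]/((a * (x : LG) + y) * LGu g - (a * (x : LG) + y) : LG).
rewrite -[RHS]/(a * ((x : LG) * LGu g - x) + ((y : LG) * LGu g - y) : LG).
by rewrite mulrDl mulrBr mulrA opprD addrACA.
Qed.

Lemma bd2_linear : linear bd2.
Proof.
apply: fs_lift_is_linear => p a x y.
have -> : ((a *: x + y : chains0) : LG) * LGu p.1
        = a *: ((x : LG) * LGu p.1 : chains0) + ((y : LG) * LGu p.1).
  by rewrite mulrDl -mulrA.
rewrite !fs_single_is_linear scalerDr scalerBr opprD.
by rewrite [X in X + _ = _]addrACA; exact: addrACA.
Qed.

Lemma bd1_bd2 c : bd1 (bd2 c) = 0.
Proof.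
have single0 (k : G) : fs_single k (0 : chains0) = 0.
  by apply: finsuppP => k' /=; case: eqP.
rewrite fs_lift_comp; first last.
- by move=> p; rewrite mul0r !single0 subr0 addr0.
- exact: bd1_linear.
rewrite /fs_lift fsbig1 // => -[g h] _ /=.
have bdB x y : bd1 (x - y) = bd1 x - bd1 y.
  by rewrite addrC -scaleN1r bd1_linear scaleN1r addrC.
have bdD x y : bd1 (x + y) = bd1 x + bd1 y.
  by have := bd1_linear 1 x y; rewrite !scale1r.
have bdE k a : bd1 (fs_single k a) = (a : LG) * LGu k - a.
  by apply: fs_lift_single => k'; rewrite mul0r subr0.
have tele (X Y Z : LG) : X - Y - (X - Z) + (Y - Z) = 0.
  by rewrite opprB [X - Y + _]addrC subrKA subrKA subrr.
by rewrite bdD bdB !bdE LGuM mulrA; exact: tele.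
Qed.

Definition cycles1_pred : {pred chains1} := fun c => bd1 c == 0.

Lemma cycles1_submod_closed : submod_closed cycles1_pred.
Proof.
have bd10 : bd1 0 = 0.
  by have := bd1_linear (-1) 0 0; rewrite scaleN1r addr0 oppr0 scaleN1r addNr.
split; first exact/eqP.
move=> a x y /eqP x0 /eqP y0; apply/eqP.
by rewrite bd1_linear x0 y0 scaler0 addr0.
Qed.

HB.instance Definition _ :=
  GRing.isSubmodClosed.Build LG chains1 cycles1_pred cycles1_submod_closed.

Record cycles1 := Cycle1 { cycle1_val :> chains1; _ : cycle1_val \in cycles1_pred }.

HB.instance Definition _ := [isSub for cycle1_val].
HB.instance Definition _ := [Choice of cycles1 by <:].
HB.instance Definition _ := [SubChoice_isSubZmodule of cycles1 by <:].
HB.instance Definition _ := [SubZmodule_isSubLmodule of cycles1 by <:].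

Definition boundaries1 : {pred cycles1} :=
  fun z => `[< exists b : chains2, bd2 b = z >].

Lemma boundaries1_submod_closed : submod_closed boundaries1.
Proof.
split.
  apply/asboolP; exists 0.
  by have := bd2_linear (-1) 0 0; rewrite scaleN1r addr0 oppr0 scaleN1r addNr.
move=> a x y /asboolP [b bx] /asboolP [c cy]; apply/asboolP.
by exists (a *: b + c); rewrite bd2_linear bx cy.
Qed.

HB.instance Definition _ :=
  GRing.isSubmodClosed.Build LG cycles1 boundaries1 boundaries1_submod_closed.

Definition H1_LG : lmodType LG := quot_lmod boundaries1.

Definition l2betti1 : \bar R := LGdim H1_LG.

Definition ZG := finsupp_fun G int^o.

Definition ZG_act (a : ZG) (x : H) : H :=
  fs_lift (fun g (n : int^o) => lreg g x *~ n) a.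

End VonNeumann.

Section Growth.
Context (G : groupType).

Definition torsion_free : Prop :=
  forall (g : G) (n : nat), (0 < n)%N -> (g ^+ n)%g = 1%g -> g = 1%g.

Definition word_ball (S : {fset G}) (n : nat) : set G :=
  [set g | exists w : seq G,
    [/\ all (fun s => (s \in S) || ((s^-1)%g \in S)) w, (size w <= n)%N
      & g = (\prod_(s <- w) s)%g]].

Definition generates (S : {fset G}) : Prop := forall g : G, exists n, word_ball S n g.

Definition finitely_generated : Prop := exists S : {fset G}, generates S.

(** Word balls are finite, so [fset_set] does enumerate them. *)
Definition growth_rate (R : realType) (S : {fset G}) : R :=
  limn (fun n => (#|` fset_set (word_ball S n)|%:R : R) `^ (n%:R^-1)).

End Growth.

Definition ceile (R : realType) (x : \bar R) : \bar R :=
  match x with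
  | r%:E => (Num.ceil r)%:~R%:E
  | +oo => +oo
  | -oo => -oo
  end%E.

(* Main.v *)
(** Modulo boundaries the bar chains [g] satisfy [gh] = [g] + g[h], so over the
    group von Neumann algebra LG they are generated by the [s] with s in S.  Take a
    subset T of S of maximal size that freely generates a free subgroup.  For s in
    S outside T there is a shortest nontrivial reduced word over T and s which is
    trivial in G; by minimality no two terms of its Fox derivative with respect to
    s cancel, so that the fundamental formula expresses a[s] through the [t], t in
    T, with a a nonzero element of ZG.  Such an a is a non-zero-divisor in LG.
    Deleting one more generator t0, because t0 - 1 is also a non-zero-divisor, a
    projective submodule LG^n A of H_1(G; LG) with tr A > #T - 1 would give a system
    of linear equations over LG with fewer equations, counted by the trace, than
    unknowns.  Such a system has a nonzero solution: if X is a contraction with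
    adjoint X', the strong limit of (1 - X X')^2n is the projection onto the left
    kernel of X, and its trace is bounded below because the traces of (1 - X X')^j
    and (1 - X' X)^j differ by a constant.
    Hence the first Betti number is at most #T - 1, while G grows at least as fast as
    the free group on T, that is, with rate at least 2 #T - 1. *)
Require Import Defs.
From HB Require Import structures.
From mathcomp Require Import all_boot all_order all_algebra.
From mathcomp Require Import finmap complex.
From mathcomp Require Import all_classical all_reals all_analysis.
From mathcomp Require Import ring lra.

Set Implicit Arguments.
Unset Strict Implicit.
Unset Printing Implicit Defensive.

Import Order.TTheory GRing.Theory Num.Theory numFieldNormedType.Exports.

Local Open Scope classical_set_scope.
Local Open Scope ring_scope.

(** * The real inner product of [l2] *)

Section L2Quadratic.
Context (R : realType) (K : choiceType).
Local Notation H := (l2 R K).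
Implicit Types x y z : H.

Fact sqn_key : unit. Proof. exact: tt. Qed.
(** Locked, so that conversion treats the infinite sum as an opaque number. *)
Definition sqn x : R := locked_with sqn_key (fine (l2sum x)).

Lemma sqnE x : l2sum x = (sqn x)%:E.
Proof. by rewrite /sqn unlock l2sum_fin. Qed.

Lemma sqn_ge0 x : 0 <= sqn x.
Proof. by rewrite /sqn unlock fine_ge0 // l2sum_ge0. Qed.

Lemma l2norm_sqn x : l2norm x ^+ 2 = sqn x.
Proof. by rewrite /sqn unlock l2norm_sqr. Qed.

(* Linear relations between squared norms are proved term by term; [esum] only
   adds up nonnegative terms, whence the nonnegative coefficients. *)
Lemma sqn_comb (s : seq (R * H)) : all (fun p => 0 <= p.1) s ->
  (\sum_(p <- s) p.1 * sqn p.2)%:E =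
  \esum_(k in [set: K]) (\sum_(p <- s) p.1 * sqnormc (p.2 k))%:E.
Proof.
have sum_ge0 (t : seq (R * H)) k : all (fun p => 0 <= p.1) t ->
    0 <= \sum_(p <- t) p.1 * sqnormc (p.2 k).
  move=> /allP t0; rewrite big_seq; apply: sumr_ge0 => p /t0 p0.
  by rewrite mulr_ge0 ?sqnormc_ge0.
elim: s => [_|[a x] s IH /= /andP[a0 s0]].
  by rewrite big_nil esum1 // => k _; rewrite big_nil.
rewrite big_cons EFinD IH //.
under [RHS]eq_esum do rewrite big_cons EFinD.
rewrite esumD; first last.
- by move=> k _; rewrite lee_fin sum_ge0.
- by move=> k _; rewrite lee_fin mulr_ge0 ?sqnormc_ge0.
congr (_ + _)%E => /=; rewrite EFinM -sqnE; apply/le_anti/andP; split.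
  have [->|an0] := eqVneq a 0.
    by rewrite mul0e esum_ge0 // => k _; rewrite mul0r.
  rewrite -lee_pdivlMl ?lt_neqAle 1?eq_sym ?an0 //.
  apply: le_trans (l2sumZ _ _) => //; last first.
  - by move=> k; rewrite mulr_ge0 // sqnormc_ge0.
  - by rewrite invr_ge0.
  by apply: le_esum => k _; rewrite mulrA mulVf ?mul1r.
by apply: l2sumZ => // k; rewrite sqnormc_ge0.
Qed.

Lemma sqn_comb_eq (s t : seq (R * H)) :
  all (fun p => 0 <= p.1) s -> all (fun p => 0 <= p.1) t ->
  (forall k, \sum_(p <- s) p.1 * sqnormc (p.2 k) = \sum_(p <- t) p.1 * sqnormc (p.2 k)) ->
  \sum_(p <- s) p.1 * sqn p.2 = \sum_(p <- t) p.1 * sqn p.2.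
Proof.
move=> s0 t0 e; apply: EFin_inj; rewrite !sqn_comb //.
by apply: eq_esum => k _; rewrite e.
Qed.

Lemma l2DE x y k : (x + y) k = (x k : R[i]) + (y k : R[i]). Proof. by []. Qed.
Lemma l2BE x y k : (x - y) k = (x k : R[i]) - (y k : R[i]). Proof. by []. Qed.
Lemma l2ZE (a : R[i]) x k : (a *: x) k = a * (x k : R[i]). Proof. by []. Qed.

Lemma sqnZ (a : R[i]) x : sqn (a *: x) = sqnormc a * sqn x.
Proof.
have := @sqn_comb_eq [:: (1, a *: x)] [:: (sqnormc a, x)].
rewrite !big_seq1 mul1r; apply => [|//=|k]; first by rewrite /= ler01.
  by rewrite /= sqnormc_ge0.
by rewrite !big_seq1 mul1r -sqnormcM.
Qed.

Lemma sqn_comb4 (a1 a2 a3 a4 b1 b2 b3 : R) (x1 x2 x3 x4 y1 y2 y3 : H) :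
  0 <= a1 -> 0 <= a2 -> 0 <= a3 -> 0 <= a4 -> 0 <= b1 -> 0 <= b2 -> 0 <= b3 ->
  (forall k, a1 * sqnormc (x1 k) + a2 * sqnormc (x2 k) + a3 * sqnormc (x3 k)
    + a4 * sqnormc (x4 k)
    = b1 * sqnormc (y1 k) + b2 * sqnormc (y2 k) + b3 * sqnormc (y3 k)) ->
  a1 * sqn x1 + a2 * sqn x2 + a3 * sqn x3 + a4 * sqn x4
  = b1 * sqn y1 + b2 * sqn y2 + b3 * sqn y3.
Proof.
move=> a1_ge0 a2_ge0 a3_ge0 a4_ge0 b1_ge0 b2_ge0 b3_ge0 e.
have := @sqn_comb_eq [:: (a1, x1); (a2, x2); (a3, x3); (a4, x4)]
  [:: (b1, y1); (b2, y2); (b3, y3)].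
rewrite !big_cons !big_nil /= !addr0 !addrA; apply.
- by rewrite a1_ge0 a2_ge0 a3_ge0 a4_ge0.
- by rewrite b1_ge0 b2_ge0 b3_ge0.
by move=> k; rewrite !big_cons !big_nil /= !addr0 !addrA e.
Qed.

Lemma sqn_comb43 (x1 x2 x3 x4 y1 y2 y3 : H) :
  (forall k, sqnormc (x1 k) + sqnormc (x2 k) + sqnormc (x3 k) + sqnormc (x4 k)
    = sqnormc (y1 k) + sqnormc (y2 k) + sqnormc (y3 k)) ->
  sqn x1 + sqn x2 + sqn x3 + sqn x4 = sqn y1 + sqn y2 + sqn y3.
Proof.
move=> e; have := @sqn_comb4 1 1 1 1 1 1 1 x1 x2 x3 x4 y1 y2 y3.
rewrite [1 * sqn x1]mul1r [1 * sqn x2]mul1r [1 * sqn x3]mul1r [1 * sqn x4]mul1r.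
rewrite [1 * sqn y1]mul1r [1 * sqn y2]mul1r [1 * sqn y3]mul1r.
move=> H1; apply: H1; last move=> k; rewrite ?ler01 //.
by rewrite 7!mul1r.
Qed.

(** This is additivity of the polarised form [ip] in disguise, with the negative terms moved across
    because [sqn_comb_eq] wants nonnegative coefficients. *)
Lemma sqn_addA x y z :
  sqn (x + y + z) + sqn x + sqn y + sqn z = sqn (x + y) + sqn (y + z) + sqn (x + z).
Proof.
apply: sqn_comb43 => k.
rewrite !l2DE.
by case: (x k) (y k) (z k) => [a b] [c d] [e f]; rewrite /sqnormc /=; ring.
Qed.

(** In the same way this encodes homogeneity of [ip]; negative scalars are reduced to it by a change
    of sign in [ipZl]. *)
Lemma sqn_addZ (a : R) x y : 0 <= a ->
  sqn (a%:C%C *: x + y) + a * sqn x + a * sqn y = a * sqn (x + y) + a ^+ 2 * sqn x + sqn y.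
Proof.
move=> a0.
have := @sqn_comb4 1 a a 0 a (a ^+ 2) 1 (a%:C%C *: x + y) x y 0 (x + y) x y.
rewrite !mul1r mul0r addr0; apply=> // [|k]; first exact: sqr_ge0.
rewrite !mul1r mul0r addr0 !l2DE l2ZE.
by case: (x k) (y k) => [b c] [d e]; rewrite /sqnormc /=; ring.
Qed.

Lemma sqn0 : sqn 0 = 0.
Proof. by rewrite -(scale0r 0) sqnZ /sqnormc /= expr0n addr0 mul0r. Qed.

Lemma sqnN x : sqn (- x) = sqn x.
Proof. by rewrite -scaleN1r sqnZ /sqnormc /= oppr0 expr0n sqrrN expr1n addr0 mul1r. Qed.

Lemma sqn_i x : sqn ('i%C *: x) = sqn x.
Proof. by rewrite sqnZ /sqnormc /= expr0n expr1n add0r mul1r. Qed.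

Lemma sqn_coord x k : sqnormc (x k) <= sqn x.
Proof.
rewrite -lee_fin -sqnE; apply: esum_ge; exists [set k].
  by split; [exact: finite_set1|].
by rewrite fsbig_set1.
Qed.

Lemma sqnormc_eq0 (z : R[i]) : (sqnormc z == 0) = (z == 0).
Proof.
case: z => a b; rewrite /sqnormc /= paddr_eq0 ?sqr_ge0 // !sqrf_eq0.
by rewrite eq_complex.
Qed.

Lemma sqn_eq0 x : sqn x = 0 -> x = 0.
Proof.
move=> x0; apply: l2P => k; change (x k = 0 :> R[i]); apply/eqP.
by rewrite -sqnormc_eq0; apply/eqP/le_anti; rewrite sqnormc_ge0 andbT -x0 sqn_coord.
Qed.

End L2Quadratic.

(* Generalizing the values keeps [ring] and [lra] from unfolding them. *)
Ltac gen_sqn := repeat match goal with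
  | |- context [sqn ?x] => move: (sqn x) => ?
  end.

Section L2Inner.
Context (R : realType) (K : choiceType).
Local Notation H := (l2 R K).
Implicit Types x y z : H.

(** The real part of the inner product. *)
Definition ip x y : R := (sqn (x + y) - sqn x - sqn y) / 2.

Lemma ipC x y : ip x y = ip y x.
Proof. by rewrite /ip [y + x]addrC; gen_sqn; ring. Qed.

Lemma ipDl x y z : ip (x + y) z = ip x z + ip y z.
Proof. by have := sqn_addA x y z; rewrite /ip; gen_sqn; lra. Qed.

Lemma ip0l x : ip 0 x = 0.
Proof. by rewrite /ip add0r sqn0 subr0 subrr mul0r. Qed.

Lemma ipNl x y : ip (- x) y = - ip x y.
Proof. by apply/eqP; rewrite -addr_eq0 -ipDl addNr ip0l. Qed.

Lemma ipZl_ge0 (a : R) x y : 0 <= a -> ip (a%:C%C *: x) y = a * ip x y.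
Proof.
move=> a0; have := sqn_addZ x y a0.
rewrite /ip sqnZ /sqnormc /= expr0n addr0; gen_sqn => e; lra.
Qed.

Lemma ipZl (a : R) x y : ip (a%:C%C *: x) y = a * ip x y.
Proof.
have [a0|a0] := leP 0 a; first exact: ipZl_ge0.
have -> : a%:C%C *: x = - ((- a)%:C%C *: x).
  by rewrite -scaleNr -rmorphN opprK.
by rewrite ipNl ipZl_ge0 ?oppr_ge0 ?ltW // mulNr opprK.
Qed.

Lemma ipDr x y z : ip x (y + z) = ip x y + ip x z.
Proof. by rewrite ipC ipDl !(ipC x). Qed.
Lemma ip0r x : ip x 0 = 0. Proof. by rewrite ipC ip0l. Qed.
Lemma ipNr x y : ip x (- y) = - ip x y. Proof. by rewrite ipC ipNl ipC. Qed.
Lemma ipZr (a : R) x y : ip x (a%:C%C *: y) = a * ip x y.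
Proof. by rewrite ipC ipZl ipC. Qed.

Lemma ip_ii x y : ip ('i%C *: x) ('i%C *: y) = ip x y.
Proof. by rewrite /ip -scalerDr !sqn_i. Qed.

(** Multiplication by i preserves [ip] and squares to -1, hence is skew. This stands in for the
    imaginary part of the Hermitian product. *)
Lemma ip_il x y : ip ('i%C *: x) y = - ip x ('i%C *: y).
Proof.
have ii : 'i%C * 'i%C = -1 :> R[i].
  by apply/eqP; rewrite eq_complex /=; apply/andP; split; apply/eqP; ring.
by rewrite -ip_ii scalerA ii scaleN1r ipNl.
Qed.

Lemma ipxx x : ip x x = sqn x.
Proof.
have -> : ip x x = (sqn ((2 : R)%:C%C *: x) - sqn x - sqn x) / 2.
  by rewrite /ip; congr ((sqn _ - _ - _) / _); rewrite -mulr2n -scaler_nat rmorph_nat.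
by rewrite sqnZ /sqnormc /=; gen_sqn; lra.
Qed.

Lemma sqnD x y : sqn (x + y) = sqn x + sqn y + 2 * ip x y.
Proof. by rewrite /ip; gen_sqn; lra. Qed.

Lemma sqnB x y : sqn (x - y) = sqn x + sqn y - 2 * ip x y.
Proof. by rewrite sqnD sqnN ipNr mulrN. Qed.

Lemma ip_eq0 x : (forall y, ip y x = 0) -> x = 0.
Proof. by move=> /(_ x); rewrite ipxx => /sqn_eq0. Qed.

Lemma ip_inj x y : (forall z, ip z x = ip z y) -> x = y.
Proof.
move=> e; apply/eqP; rewrite -subr_eq0; apply/eqP/ip_eq0 => z.
by rewrite ipDr ipNr e subrr.
Qed.

Lemma cauchy_schwarz x y : ip x y ^+ 2 <= sqn x * sqn y.
Proof.
have [y0|y0] := eqVneq (sqn y) 0.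
  by rewrite (sqn_eq0 y0) ip0r sqn0 mulr0 expr0n.
have yp : 0 < sqn y by rewrite lt_neqAle eq_sym y0 sqn_ge0.
(* The component of x orthogonal to y, scaled by [sqn y] to avoid a division. *)
have := sqn_ge0 ((sqn y)%:C%C *: x - (ip x y)%:C%C *: y).
rewrite sqnB ipZl ipZr !sqnZ /sqnormc /= expr0n /= !addr0 => h.
rewrite -subr_ge0 -(pmulr_rge0 _ yp).
rewrite (_ : sqn y * _ = sqn y ^+ 2 * sqn x + ip x y ^+ 2 * sqn y -
  2 * (sqn y * (ip x y * ip x y))) //.
by move: (ip x y) => ?; gen_sqn; ring.
Qed.

End L2Inner.

(** * Density, adjoints and completeness in the Hilbert space *)

Section L2Hilbert.
Context (R : realType) (K : choiceType).
Local Notation H := (l2 R K).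
Implicit Types x y z : H.

Lemma l2_ZdeltaE (a : R[i]) (k h : K) : (a *: l2delta R k) h = if h == k then a else 0.
Proof. by rewrite l2ZE /=; case: eqP => _; rewrite ?mulr1 ?mulr0. Qed.

Lemma sqnormc0 : sqnormc (0 : R[i]) = 0.
Proof. by apply/eqP; rewrite sqnormc_eq0. Qed.

Lemma l2sum_finsupp (s : seq K) (f : K -> R[i]^o) : uniq s ->
  (forall k, k \notin s -> f k = 0) -> l2sum f = (\sum_(k <- s) sqnormc (f k))%:E.
Proof.
move=> us f0; rewrite /l2sum -sumEFin.
have -> : \esum_(k in [set: K]) (sqnormc (f k))%:E
        = \esum_(k in [set` s]) (sqnormc (f k))%:E.
  rewrite [RHS]esum_mkcond; apply: eq_esum => k _.
  case: ifPn => // /negP; rewrite inE /= => ks; rewrite f0 ?sqnormc0 //; exact/negP.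
rewrite esum_fset; first by rewrite -fsbig_seq.
  exact: finite_seq.
by move=> k _; rewrite lee_fin sqnormc_ge0.
Qed.

Lemma sqn_finsupp (s : seq K) x : uniq s ->
  (forall k, k \notin s -> x k = 0) -> sqn x = \sum_(k <- s) sqnormc (x k).
Proof. by move=> us x0; apply: EFin_inj; rewrite -sqnE (l2sum_finsupp us x0). Qed.

Lemma sqn_Zdelta (a : R[i]) (k : K) : sqn (a *: l2delta R k) = sqnormc a.
Proof.
rewrite (@sqn_finsupp [:: k]) //.
  by rewrite big_seq1 l2_ZdeltaE eqxx.
by move=> h; rewrite inE l2_ZdeltaE => /negPf ->.
Qed.

Lemma sqn_disjoint x y : (forall k, x k = 0 \/ y k = 0) -> sqn (x + y) = sqn x + sqn y.
Proof.
move=> d; have := @sqn_comb43 _ _ (x + y) 0 0 0 x y 0.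
rewrite sqn0 !addr0; apply=> k; rewrite l2DE sqnormc0 !addr0.
by case: (d k) => ->; rewrite ?sqnormc0 ?add0r ?addr0.
Qed.

Lemma ip_disjoint x y : (forall k, x k = 0 \/ y k = 0) -> ip x y = 0.
Proof. by move=> d; rewrite /ip sqn_disjoint //; gen_sqn; lra. Qed.

(** The value is the real part of conj(a) x(k): what remains of x after removing its component at k
    has support disjoint from k. *)
Lemma ip_Zdelta x (a : R[i]) k :
  ip x (a *: l2delta R k) = complex.Re a * complex.Re (x k) + complex.Im a * complex.Im (x k).
Proof.
pose x' := x - x k *: l2delta R k.
have -> : x = x' + x k *: l2delta R k by rewrite subrK.
rewrite ipDl ip_disjoint ?add0r; last first.
  move=> h; rewrite l2_ZdeltaE; case: eqP => [->|]; [left|by right].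
  by rewrite l2BE l2_ZdeltaE eqxx subrr.
rewrite l2DE l2_ZdeltaE eqxx l2BE l2_ZdeltaE eqxx subrr add0r.
rewrite /ip -scalerDl !sqn_Zdelta; case: (x k : R[i]) a => [b c] [d e] /=.
by rewrite /sqnormc /=; field.
Qed.

Definition fcomb (s : seq K) (f : K -> R[i]) : H := \sum_(k <- s) f k *: l2delta R k.

Lemma fcombE s f (h : K) : uniq s -> fcomb s f h = if h \in s then f h else 0.
Proof.
rewrite /fcomb; elim: s => [|k s IH] /=; first by rewrite big_nil.
move=> /andP[ks us]; rewrite big_cons l2DE l2_ZdeltaE IH // in_cons.
by have [->|_] := eqVneq h k; rewrite ?(negPf ks) ?addr0 ?add0r.
Qed.

Lemma sqn_fcomb s f : uniq s -> sqn (fcomb s f) = \sum_(k <- s) sqnormc (f k).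
Proof.
move=> us; rewrite (sqn_finsupp us); last by move=> k /negPf ks; rewrite fcombE // ks.
by rewrite !big_seq; apply: eq_bigr => k ks; rewrite fcombE // ks.
Qed.

Lemma sqn_split s x : uniq s -> sqn x = sqn (fcomb s x) + sqn (x - fcomb s x).
Proof.
move=> us; rewrite -sqn_disjoint ?subrKC // => k.
rewrite l2BE fcombE //.
by case: (k \in s); [right; rewrite subrr|left].
Qed.

Lemma fcomb_approx x (e : R) : 0 < e -> exists2 s, uniq s & sqn (x - fcomb s x) < e.
Proof.
move=> e0.
have fin : l2sum x \is a fin_num by rewrite sqnE.
have [_ [A [fA _] <-]] := ub_ereal_sup_adherent e0 fin.
rewrite [X in (X - _ < _)%E]sqnE fsbig_finite //= sumEFin -EFinB lte_fin => h.
exists (fset_set A); first exact: fset_uniq.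
rewrite (sqn_split x (fset_uniq (fset_set A))) [sqn (fcomb _ _)]sqn_fcomb // in h.
by move: h; gen_sqn; move: (\sum_(i <- _) _) => ?; lra.
Qed.

(** Finite combinations of the deltas are dense, and the quadratic bound makes the additive [phi]
    continuous. *)
Lemma dense_delta (phi : H -> R) (M : R) :
  {morph phi : x y / x + y} -> (forall x, phi x ^+ 2 <= M * sqn x) ->
  (forall a k, phi (a *: l2delta R k) = 0) -> forall x, phi x = 0.
Proof.
move=> phiD phiM phi0 x.
have phi00 : phi 0 = 0 by have := phiD 0 0; rewrite addr0; lra.
have phif s f : phi (fcomb s f) = 0.
  by rewrite /fcomb (big_morph phi phiD phi00) big1 // => k _; rewrite phi0.
apply/eqP; rewrite -sqrf_eq0 -[_ == 0]negbK; apply/negP => px.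
have pp : 0 < phi x ^+ 2 by rewrite lt_neqAle eq_sym px sqr_ge0.
have M0 : 0 < `|M| + 1 by rewrite ltr_wpDl.
have [s us hs] := fcomb_approx x (divr_gt0 pp M0).
have ex : phi x = phi (x - fcomb s x).
  have := phiD (x - fcomb s x) (fcomb s x).
  rewrite subrK => ->; rewrite -[RHS]addr0; congr (_ + _); exact: phif.
have := phiM (x - fcomb s x); rewrite -ex => h.
have : phi x ^+ 2 <= `|M| * (phi x ^+ 2 / (`|M| + 1)).
  apply: le_trans h _; apply: (@le_trans _ _ (`|M| * sqn (x - fcomb s x))).
    by rewrite ler_wpM2r ?sqn_ge0 // ler_norm.
  by rewrite ler_wpM2l // ltW.
apply/negP; rewrite -ltNge mulrA ltr_pdivrMr // mulrDr mulr1 [X in X < _]mulrC.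
by rewrite ltrDl.
Qed.

Lemma l2_of_bound (f : K -> R[i]^o) (M : R) :
  (forall s : seq K, uniq s -> \sum_(k <- s) sqnormc (f k) <= M) ->
  exists2 x : H, (forall k, x k = f k) & sqn x <= M.
Proof.
move=> fM.
have le : (l2sum f <= M%:E)%E.
  apply: ge_ereal_sup => _ [X [fX _] <-].
  by rewrite fsbig_finite //= sumEFin lee_fin fM // fset_uniq.
have fP : f \in l2_pred (R := R) (K := K).
  by apply/asboolP/(le_lt_trans le); rewrite ltry.
by exists (L2Fun fP) => //; rewrite -lee_fin -sqnE.
Qed.

Lemma bounded_opP (T : H -> H) :
  bounded_op T <-> linear T /\ exists2 M : R, 0 <= M & forall x, sqn (T x) <= M * sqn x.
Proof.
split=> -[linT b]; (split; first exact: linT).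
  case: b => M bM; exists (M ^+ 2); first exact: sqr_ge0.
  move=> x; rewrite -!l2norm_sqn -exprMn; apply: lerXn2r (bM x) => //.
    by rewrite nnegrE l2norm_ge0.
  by rewrite nnegrE (le_trans _ (bM x)) // l2norm_ge0.
case: b => M M0 bM; exists (Num.sqrt M) => x.
rewrite -(@ler_pXn2r _ 2) ?nnegrE ?mulr_ge0 ?l2norm_ge0 ?sqrtr_ge0 //.
by rewrite exprMn !l2norm_sqn sqr_sqrtr.
Qed.

(** [T' y] is built from its coordinates: the one at k collects the pairings of y with the images of
    delta_k and i delta_k. Boundedness of T makes it square summable, and the adjoint relation
    extends from the deltas by density. *)
Lemma bounded_adjoint (T : H -> H) : bounded_op T ->
  exists2 T', bounded_op T' & forall x y, ip (T x) y = ip x (T' y).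
Proof.
move=> /bounded_opP[linT [M M0 TM]].
have T0 : T 0 = 0.
  by have := linT (-1) 0 0; rewrite scaleN1r addr0 oppr0 scaleN1r addNr.
have TD : {morph T : x y / x + y} by move=> x y; rewrite -{1}[x]scale1r linT scale1r.
have TZ a x : T (a *: x) = a *: T x by rewrite -[a *: x]addr0 linT T0 addr0.
pose f y k := (ip (T (l2delta R k)) y +i* ip (T ('i%C *: l2delta R k)) y)%C : R[i]^o.
have ipf y a k : ip (T (a *: l2delta R k)) y
    = complex.Re a * complex.Re (f y k) + complex.Im a * complex.Im (f y k).
  rewrite (_ : a = (complex.Re a)%:C%C + (complex.Im a)%:C%C * 'i%C); last first.
    by case: a => b c; apply/eqP; rewrite eq_complex /=; apply/andP; split; apply/eqP; ring.
  rewrite scalerDl -scalerA TD !TZ ipDl !ipZl /= -TZ.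
  by move: (ip _ _) (ip _ _) => u v; ring.
(* Pairing y with the image of the truncation of [f y] itself gives t, so Cauchy-Schwarz yields t^2
   <= M t [sqn y], and t cancels. *)
have fM y s : uniq s -> \sum_(k <- s) sqnormc (f y k) <= M * sqn y.
  move=> us; set t := \sum_(k <- s) _.
  have e : ip (T (fcomb s (f y))) y = t.
    rewrite /fcomb (big_morph T TD T0).
    rewrite (big_morph (fun z => ip z y) (fun z w => ipDl z w y) (ip0l y)).
    by apply: eq_bigr => k _; rewrite ipf /sqnormc -!expr2.
  have := cauchy_schwarz (T (fcomb s (f y))) y; rewrite e => h.
  have := TM (fcomb s (f y)); rewrite sqn_fcomb // -/t => h'.
  have t0 : 0 <= t by apply: sumr_ge0 => k _; exact: sqnormc_ge0.
  have := sqn_ge0 y.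
  have {}h : t ^+ 2 <= M * t * sqn y.
    by apply: le_trans h _; rewrite ler_wpM2r // sqn_ge0.
  move: (sqn y) h => q h q0.
  have [->|tn] := eqVneq t 0; first exact: mulr_ge0.
  have tp : 0 < t by rewrite lt_neqAle eq_sym tn.
  by rewrite -(ler_pM2l tp) -expr2 mulrA [t * M]mulrC.
have [y|T' T'E] := @choice _ _ (fun y z : H => (forall k, z k = f y k) /\ sqn z <= M * sqn y).
  by have [z] := l2_of_bound (fM y); exists z.
have adj x y : ip (T x) y = ip x (T' y).
  apply/eqP; rewrite -subr_eq0; apply/eqP.
  apply: (@dense_delta (fun x => ip (T x) y - ip x (T' y))
     (2 * (M * sqn y) + 2 * sqn (T' y))) => {x}.
  - by move=> x z; rewrite TD !ipDl; rewrite opprD addrACA.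
  - move=> x; have := cauchy_schwarz (T x) y; have := cauchy_schwarz x (T' y).
    have := TM x; have := sqn_ge0 y.
    move: (ip (T x) y) (ip x (T' y)) (sqn (T x)) (sqn x) (sqn y) (sqn (T' y)).
    move=> a b p r q w q0 h1 h2 h3.
    have h4 : p * q <= M * r * q by rewrite ler_wpM2r.
    have h5 := sqr_ge0 (a + b).
    have -> : (2 * (M * q) + 2 * w) * r = 2 * (M * r * q) + 2 * (r * w) by ring.
    have -> : (a - b) ^+ 2 = 2 * a ^+ 2 + 2 * b ^+ 2 - (a + b) ^+ 2 by ring.
    by move: (M * r * q) (p * q) (r * w) (a ^+ 2) (b ^+ 2) ((a + b) ^+ 2)
      h2 h3 h4 h5 => *; lra.
  - move=> a k; rewrite ipf [ip _ (T' y)]ipC ip_Zdelta; have [e _] := T'E y.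
    by rewrite e subrr.
exists T' => //; apply/bounded_opP; split; last by exists M => // x; have [] := T'E x.
move=> a x y; apply: ip_inj => z; rewrite -adj !ipDr -!adj.
(* [ip] is only real bilinear, so a complex scalar is split and its imaginary part handled by
   skewness of i. *)
rewrite (_ : a = (complex.Re a)%:C%C + (complex.Im a)%:C%C * 'i%C); last first.
  by case: a => b c; apply/eqP; rewrite eq_complex /=; apply/andP; split; apply/eqP; ring.
rewrite !scalerDl -!scalerA !ipDr !ipZr -adj; congr (_ + _ * _ + _).
by apply: oppr_inj; rewrite -!ip_il -TZ adj.
Qed.

Lemma cvg_cauchy (u : nat -> R) :
  (forall e, 0 < e -> exists N, forall n m, (N <= n)%N -> (N <= m)%N -> `|u n - u m| < e) ->
  cvgn u.
Proof.
move=> cu; apply/cauchy_cvgP/cauchy_exP => e e0.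
have [N hN] := cu e e0; exists (u N); exists N => // n /= Nn.
by rewrite /ball /= hN.
Qed.

Lemma cvg_sumr (I : Type) (s : seq I) (u : I -> nat -> R) (l : I -> R) :
  (forall i, u i n @[n --> \oo] --> l i) ->
  (\sum_(i <- s) u i n) @[n --> \oo] --> \sum_(i <- s) l i.
Proof.
move=> ul; elim: s => [|i s IH].
  rewrite big_nil (_ : (fun n => _) = fun=> 0); first exact: cvg_cst.
  by apply/funext => n; rewrite big_nil.
rewrite big_cons (_ : (fun n => _) = fun n => u i n + \sum_(j <- s) u j n).
  exact: cvgD.
by apply/funext => n; rewrite big_cons.
Qed.

Definition sqn_cvg (u : nat -> H) x :=
  forall e, 0 < e -> exists N, forall n, (N <= n)%N -> sqn (u n - x) <= e.

Definition sqn_cauchy (u : nat -> H) := forall e, 0 < e ->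
  exists N, forall n m, (N <= n)%N -> (N <= m)%N -> sqn (u n - u m) <= e.

(** The coordinates converge because R is complete, and the Cauchy bounds pass to the coordinatewise
    limit through finite partial sums. *)
Lemma l2_complete (u : nat -> H) : sqn_cauchy u -> exists x, sqn_cvg u x.
Proof.
move=> cu.
have cc (p : R[i] -> R) (k : K) : (forall z w : R[i], (p z - p w) ^+ 2 <= sqnormc (z - w)) ->
    cvgn (fun n => p (u n k)).
  move=> pz; apply: cvg_cauchy => e e0.
  (* Halving turns the weak inequality of [sqn_cauchy] into a strict one. *)
  have [N hN] := cu (e ^+ 2 / 2) (divr_gt0 (exprn_gt0 _ e0) (ltr0Sn _ 1)).
  exists N => n m Nn Nm; rewrite -(@ltr_pXn2r _ 2) ?nnegrE ?normr_ge0 ?(ltW e0) // real_normK ?num_real //.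
  apply: le_lt_trans (pz _ _) _; apply: le_lt_trans (sqn_coord (u n - u m) k) _.
  apply: le_lt_trans (hN _ _ Nn Nm) _.
  have : 0 < e ^+ 2 by exact: exprn_gt0.
  by move: (e ^+ 2) => t; lra.
have cRe (k : K) : cvgn (fun n => complex.Re (u n k)).
  apply: (@cc (@complex.Re _) k) => -[a b] [c d]; rewrite /sqnormc /= lerDl; exact: sqr_ge0.
have cIm (k : K) : cvgn (fun n => complex.Im (u n k)).
  apply: (@cc (@complex.Im _) k) => -[a b] [c d]; rewrite /sqnormc /= lerDr; exact: sqr_ge0.
pose f k : R[i]^o := (limn (fun n => complex.Re (u n k)) +i* limn (fun n => complex.Im (u n k)))%C.
have bnd e N : (forall n m, (N <= n)%N -> (N <= m)%N -> sqn (u n - u m) <= e) ->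
    forall n, (N <= n)%N -> forall s : seq K, uniq s ->
    \sum_(k <- s) sqnormc (u n k - f k) <= e.
  move=> hN n Nn s us.
  apply: (@ler_cvg_to _ \oo _ _ (fun m => \sum_(k <- s) sqnormc (u n k - u m k)) (fun=> e)).
  - apply: (@cvg_sumr _ s (fun k m => sqnormc (u n k - u m k : R[i]))
      (fun k => sqnormc (u n k - f k : R[i]))) => k; rewrite /sqnormc.
    rewrite (_ : (fun m => _) = fun m =>
      (complex.Re (u n k) - complex.Re (u m k)) * (complex.Re (u n k) - complex.Re (u m k))
      + (complex.Im (u n k) - complex.Im (u m k)) * (complex.Im (u n k) - complex.Im (u m k)));
      last first.
      by apply/funext => m; case: (u n k) (u m k) => [a b] [c d]; rewrite !expr2.
    rewrite [X in _ --> X](_ : _ =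
      (complex.Re (u n k) - complex.Re (f k)) * (complex.Re (u n k) - complex.Re (f k))
      + (complex.Im (u n k) - complex.Im (f k)) * (complex.Im (u n k) - complex.Im (f k)));
      last first.
      by case: (u n k) => a b; rewrite !expr2.
    by apply: cvgD; apply: cvgM; apply: cvgB; [exact: cvg_cst|exact: cRe|exact: cvg_cst|
      exact: cRe|exact: cvg_cst|exact: cIm|exact: cvg_cst|exact: cIm].
  - exact: cvg_cst.
  - exists N => // m /= Nm; apply: le_trans (hN _ _ Nn Nm).
    rewrite (sqn_split (u n - u m) us) sqn_fcomb //.
    by rewrite lerDl sqn_ge0.
have [N0 hN0] := cu 1 ltr01.
have [y yE _] := l2_of_bound (bnd _ _ hN0 N0 (leqnn _)).
(* Square summability is known for the difference [y] of [u N0] and the limit f, so f is recovered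
   as [u N0 - y]. *)
exists (u N0 - y) => e e0; have [N hN] := cu e e0; exists N => n Nn.
have [z zE ze] := l2_of_bound (bnd _ _ hN n Nn).
suff -> : u n - (u N0 - y) = z by [].
apply: l2P => k; rewrite zE.
change ((u n k : R[i]) - (u N0 k - y k) = u n k - f k).
by rewrite yE subKr.
Qed.

Lemma eq_sqn_cvg u v x : (forall n, v n = u n) -> sqn_cvg u x -> sqn_cvg v x.
Proof. by move=> e ux d d0; have [N hN] := ux d d0; exists N => n /hN; rewrite e. Qed.

Lemma sqnD_le x y : sqn (x + y) <= 2 * sqn x + 2 * sqn y.
Proof.
have := sqn_ge0 (x - y); rewrite sqnB sqnD; move: (ip x y) => ?; gen_sqn; lra.
Qed.

Lemma sqn_cvgD u v x y : sqn_cvg u x -> sqn_cvg v y ->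
  sqn_cvg (fun n => u n + v n) (x + y).
Proof.
move=> ux vy e e0; have e4 : 0 < e / 4 by rewrite divr_gt0.
have [N hN] := ux _ e4; have [M hM] := vy _ e4.
exists (maxn N M) => n; rewrite geq_max => /andP[/hN h1 /hM h2].
rewrite opprD addrACA; apply: le_trans (sqnD_le _ _) _.
by move: h1 h2; gen_sqn; lra.
Qed.

Lemma sqn_cvg_sum (I : Type) (s : seq I) (u : I -> nat -> H) (x : I -> H) :
  (forall i, sqn_cvg (u i) (x i)) ->
  sqn_cvg (fun n => \sum_(i <- s) u i n) (\sum_(i <- s) x i).
Proof.
move=> ux; elim: s => [e e0|i s IH].
  by exists 0%N => n _; rewrite !big_nil subrr sqn0 ltW.
move=> e e0; have [N hN] := sqn_cvgD (ux i) IH e0.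
by exists N => n Nn; rewrite !big_cons; exact: hN.
Qed.

Lemma sqn_cvg_op (T : H -> H) (M : R) u x : {morph T : x y / x - y} ->
  (forall x, sqn (T x) <= M * sqn x) -> sqn_cvg u x -> sqn_cvg (fun n => T (u n)) (T x).
Proof.
move=> TB TM ux e e0; have M1 : 0 < `|M| + 1 by rewrite ltr_wpDl.
have [N hN] := ux _ (divr_gt0 e0 M1); exists N => n Nn.
rewrite -TB; apply: le_trans (TM _) _.
apply: (@le_trans _ _ ((`|M| + 1) * sqn (u n - x))).
  by rewrite ler_wpM2r ?sqn_ge0 // (le_trans (ler_norm M)) // lerDl.
by rewrite mulrC -ler_pdivlMr // hN.
Qed.

Lemma sqn_cvg_ip u x y : sqn_cvg u x -> ip (u n) y @[n --> \oo] --> ip x y.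
Proof.
move=> ux; apply/cvgrPdist_le => e e0.
have y1 : 0 < sqn y + 1 by rewrite ltr_wpDl ?sqn_ge0.
have [N hN] := ux _ (divr_gt0 (exprn_gt0 2 e0) y1).
exists N => // n /= Nn.
rewrite -(@ler_pXn2r _ 2) ?nnegrE ?normr_ge0 ?(ltW e0) // real_normK ?num_real //.
rewrite -ipNl -ipDl; apply: le_trans (cauchy_schwarz _ _) _.
rewrite -opprB sqnN.
apply: (@le_trans _ _ (sqn (u n - x) * (sqn y + 1))).
  by rewrite ler_wpM2l ?sqn_ge0 // lerDl.
by rewrite -ler_pdivlMr // hN.
Qed.

Lemma sqn_cvg_uniq u x y : sqn_cvg u x -> sqn_cvg u y -> x = y.
Proof.
move=> ux uy; apply: ip_inj => z; rewrite !(ipC z).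
rewrite -(cvg_lim (@Rhausdorff R) (@sqn_cvg_ip _ _ z ux)).
exact: (cvg_lim (@Rhausdorff R) (@sqn_cvg_ip _ _ z uy)).
Qed.

(** Pass to the limit in [ip (u n) x <= (sqn (u n) + sqn x) / 2]. *)
Lemma sqn_cvg_le u x (M : R) : (forall n, sqn (u n) <= M) -> sqn_cvg u x -> sqn x <= M.
Proof.
move=> uM ux.
have : ip x x <= (M + sqn x) / 2.
  apply: (@ler_cvg_to _ \oo _ _ (fun n => ip (u n) x) (fun=> (M + sqn x) / 2)).
  - exact: sqn_cvg_ip.
  - exact: cvg_cst.
  - exists 0%N => // n _ /=; have := sqn_ge0 (u n - x); rewrite sqnB.
    by have := uM n; move: (ip _ _) => ?; gen_sqn; lra.
by rewrite ipxx; gen_sqn; lra.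
Qed.

End L2Hilbert.

(** * Adjoints and the trace of the group von Neumann algebra *)

Section GroupVN.
Context (R : realType) (G : groupType).
Local Notation H := (l2 R G).
Local Notation LGt := (LG R G).
Implicit Types (x y z : H) (S T : LGt).

Lemma LG_bounded T : bounded_op T.
Proof. by case: T => T /= /asboolP[]. Qed.

Lemma LG_comm T (S : H -> H) x : lreg_commutant S -> T (S x) = S (T x).
Proof. by case: T => T /= /asboolP[_ cT] cS; exact: cT. Qed.

Lemma LG_sqn T : exists2 M : R, 0 <= M & forall x, sqn (T x) <= M * sqn x.
Proof. by have [] := (bounded_opP T).1 (LG_bounded T). Qed.

Lemma linearD_op (T : H -> H) : linear T -> {morph T : x y / x + y}.
Proof. by move=> linT x y; rewrite -{1}[x]scale1r linT scale1r. Qed.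

Lemma linear0_op (T : H -> H) : linear T -> T 0 = 0.
Proof. by move=> linT; have := linT (-1) 0 0; rewrite scaleN1r addr0 oppr0 scaleN1r addNr. Qed.

Lemma LGfD T x y : T (x + y) = T x + T y.
Proof. exact/linearD_op/LG_linear. Qed.
Lemma LGf0 T : T 0 = 0. Proof. exact/linear0_op/LG_linear. Qed.
Lemma LGfZ T a x : T (a *: x) = a *: T x.
Proof. by rewrite -[a *: x]addr0 LG_linear LGf0 addr0. Qed.
Lemma LGfN T x : T (- x) = - T x.
Proof. by rewrite -scaleN1r LGfZ scaleN1r. Qed.
Lemma LGf_sum T (I : Type) (s : seq I) (F : I -> H) :
  T (\sum_(i <- s) F i) = \sum_(i <- s) T (F i).
Proof. exact: (big_morph T (LGfD T) (LGf0 T)). Qed.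

Lemma LG0E x : (0 : LGt) x = 0. Proof. by []. Qed.
Lemma LG1E x : (1 : LGt) x = x. Proof. by []. Qed.
Lemma LGDE S T x : (S + T) x = S x + T x. Proof. by []. Qed.
Lemma LGNE T x : (- T) x = - T x. Proof. by []. Qed.
Lemma LGME S T x : (S * T) x = S (T x). Proof. by []. Qed.

Lemma LG_sumE (I : Type) (s : seq I) (F : I -> LGt) x :
  (\sum_(i <- s) F i) x = \sum_(i <- s) F i x.
Proof. by elim/big_rec2: _ => // i y S _ <-. Qed.

Lemma sqn_lreg g x : sqn (lreg g x) = sqn x.
Proof. by apply: EFin_inj; rewrite -!sqnE lreg_l2sum. Qed.

Lemma lregM g h x : lreg g (lreg h x) = lreg (g * h)%g x.
Proof. by apply: l2P => k /=; rewrite invgM mulgA. Qed.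

Lemma lreg1 x : lreg 1%g x = x.
Proof. by apply: l2P => k /=; rewrite invg1 mul1g. Qed.

Lemma ip_lreg g x y : ip (lreg g x) y = ip x (lreg g^-1 y).
Proof.
have e z w : ip (lreg g z) (lreg g w) = ip z w.
  by rewrite /ip -(linearD_op (@lreg_linear R G g)) !sqn_lreg.
by rewrite -(e x) lregM mulgV lreg1.
Qed.

(** The adjoint of a left translation is the translation by the inverse, so commutation with all of
    them passes to the adjoint. *)
Lemma commutant_adjoint (S S' : H -> H) : bounded_op S' ->
  (forall x y, ip (S x) y = ip x (S' y)) -> lreg_commutant S -> lreg_commutant S'.
Proof.
move=> bS' adj [_ cS]; split=> // g x; apply: ip_inj => z.
rewrite -adj; transitivity (ip (lreg g^-1 (S z)) x); first by rewrite ip_lreg invgK.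
by rewrite -cS adj ip_lreg invgK.
Qed.

(** The adjoint of T commutes with S because T commutes with the adjoint of S, which is again in the
    commutant. *)
Lemma LG_adjoint_ex T : exists T' : LGt, forall x y, ip (T x) y = ip x (T' y).
Proof.
have [T' bT' adjT] := bounded_adjoint (LG_bounded T).
suff T'P : T' \in LG_pred (R := R) (G := G) by exists (MkLG T'P).
apply/asboolP; split=> // S cS x; apply: ip_inj => z.
have [S' bS' adjS] := bounded_adjoint cS.1.
have adjS2 u v : ip u (S v) = ip (S' u) v by rewrite ipC adjS ipC.
by rewrite -adjT !adjS2 -adjT (LG_comm _ _ (commutant_adjoint bS' adjS cS)).
Qed.

Definition LGadj T : LGt := projT1 (cid (LG_adjoint_ex T)).

Lemma LGadjP T x y : ip (T x) y = ip x (LGadj T y).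
Proof. by rewrite /LGadj; case: cid. Qed.

Lemma LGadjPr T x y : ip x (T y) = ip (LGadj T x) y.
Proof. by rewrite ipC LGadjP ipC. Qed.

Lemma rreg_l2sum (g : G) (x : G -> R[i]^o) : l2sum (fun h => x (h * g)%g) = l2sum x.
Proof.
rewrite /l2sum (@reindex_esum R G G setT setT (fun h => (h * g)%g)) //.
split=> //; first by move=> h k _ _ /mulIg.
by move=> h _; exists (h * g^-1)%g => //; rewrite mulgVK.
Qed.

Lemma rreg_subproof (g : G) x : (fun h => x (h * g)%g) \in l2_pred (R := R) (K := G).
Proof. by apply/asboolP; rewrite rreg_l2sum; case: x => x /= /asboolP. Qed.

(** Right translations lie in the commutant of the left ones, so an element of LG commutes with them
    and is determined by its value at delta_e. *)
Definition rreg (g : G) x : H := L2Fun (rreg_subproof g x).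

Lemma rreg_commutant g : lreg_commutant (rreg g).
Proof.
split; last by move=> h x; apply: l2P => k /=; rewrite mulgA.
split; first by move=> a x y; apply: l2P.
by exists 1 => x; rewrite mul1r /l2norm rreg_l2sum.
Qed.

Local Notation delta := (l2delta R (1%g : G)).

Lemma l2delta_rreg g : l2delta R g = rreg g^-1 delta.
Proof. by apply: l2P => h /=; rewrite divg_eq1. Qed.

Lemma LG_deltaE T (g h : G) : T (l2delta R g) h = T delta (h * g^-1)%g.
Proof. by rewrite l2delta_rreg (LG_comm _ _ (rreg_commutant _)). Qed.

Lemma LG_delta_inj S T : (forall g, S (l2delta R g) = T (l2delta R g)) -> S = T.
Proof.
move=> e; apply: LGP => x; apply: ip_inj => z.
apply/eqP; rewrite -subr_eq0 -ipNr -ipDr; apply/eqP.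
have [M M0 SM] := LG_sqn (S - T).
rewrite ipC; apply: (@dense_delta _ _ (fun x => ip ((S - T) x) z) (M * sqn z)).
- by move=> {}x y; rewrite LGfD ipDl.
- move=> {}x; apply: le_trans (cauchy_schwarz _ _) _.
  by rewrite mulrAC; apply: ler_wpM2r; rewrite ?sqn_ge0.
- move=> a k; rewrite LGfZ LGDE LGNE e subrr scaler0 ip0l //.
Qed.

Definition retr T : R := complex.Re (LGtr T).

Lemma retrE T : retr T = ip (T delta) delta.
Proof. by rewrite -[delta in RHS]scale1r ip_Zdelta /= mul1r mul0r addr0 scale1r. Qed.

Lemma retrD S T : retr (S + T) = retr S + retr T.
Proof. by rewrite !retrE LGDE ipDl. Qed.
Lemma retr0 : retr 0 = 0. Proof. by rewrite retrE ip0l. Qed.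
Lemma retrN T : retr (- T) = - retr T. Proof. by rewrite !retrE LGNE ipNl. Qed.
Lemma retr1 : retr 1 = 1.
Proof. by rewrite /retr /LGtr /= eqxx. Qed.
Lemma retr_sum (I : Type) (s : seq I) (F : I -> LGt) :
  retr (\sum_(i <- s) F i) = \sum_(i <- s) retr (F i).
Proof. exact: (big_morph retr retrD retr0). Qed.

(* The antiunitary [x |-> (g |-> conj (x g^-1))], which maps [T delta] to [T^* delta]. *)
Definition conjinv (x : G -> R[i]^o) (g : G) : R[i]^o :=
  (complex.Re (x g^-1%g) -i* complex.Im (x g^-1%g))%C.

Lemma conjinv_l2sum (x : G -> R[i]^o) : l2sum (conjinv x) = l2sum x.
Proof.
rewrite /l2sum [LHS](@reindex_esum R G G setT setT (fun g => g^-1%g)); last first.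
  split=> //; first by move=> h k _ _; exact: invg_inj.
  by move=> h _; exists h^-1%g => //; rewrite invgK.
by apply: eq_esum => k _; rewrite /conjinv invgK /sqnormc /= sqrrN.
Qed.

Lemma conjinv_subproof x : conjinv x \in l2_pred (R := R) (K := G).
Proof. by apply/asboolP; rewrite conjinv_l2sum; case: x => x /= /asboolP. Qed.

Definition l2J x : H := L2Fun (conjinv_subproof x).

Lemma sqn_l2J x : sqn (l2J x) = sqn x.
Proof. by apply: EFin_inj; rewrite -!sqnE conjinv_l2sum. Qed.

Lemma l2JK x : l2J (l2J x) = x.
Proof.
by apply: l2P => g /=; rewrite /conjinv /= /conjinv invgK opprK; case: (x g).
Qed.

Lemma l2JD : {morph l2J : x y / x + y}.
Proof.
move=> x y; apply: l2P => g; rewrite l2DE.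
change (complex.Re ((x + y) g^-1%g) -i* complex.Im ((x + y) g^-1%g)
  = (complex.Re (x g^-1%g) -i* complex.Im (x g^-1%g)) +
    (complex.Re (y g^-1%g) -i* complex.Im (y g^-1%g)) :> R[i])%C.
rewrite l2DE; case: (x _) (y _) => [a b] [c d].
by apply/eqP; rewrite eq_complex /= opprD !eqxx.
Qed.

Lemma l2J0 : l2J 0 = 0.
Proof. by apply: (addIr (l2J 0)); rewrite -l2JD !add0r. Qed.

Lemma ip_l2J x y : ip (l2J x) (l2J y) = ip x y.
Proof. by rewrite /ip -l2JD !sqn_l2J. Qed.

Lemma ip_delta_inj x y :
  (forall (a : R[i]) g, ip x (a *: l2delta R g) = ip y (a *: l2delta R g)) -> x = y.
Proof.
move=> e; apply: l2P => g; have := e 1 g; have := e 'i%C g; rewrite !ip_Zdelta /=.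
rewrite !mul1r !mul0r !add0r !addr0.
by case: (x g) (y g) => [a b] [c d] /= -> ->.
Qed.

Lemma LGadj_delta T : LGadj T delta = l2J (T delta).
Proof.
apply: ip_delta_inj => a g.
rewrite ipC -LGadjP LGfZ -[in LHS](scale1r delta) ip_Zdelta ip_Zdelta l2ZE.
rewrite LG_deltaE mul1g /= /conjinv /=.
by case: a (T delta g^-1%g) => [b c] [d e] /=; ring.
Qed.

(** Move S across as its adjoint; at delta_e the adjoint acts through the isometry [l2J], which lets
    the roles of S and T be exchanged. *)
Lemma retrM S T : retr (S * T) = retr (T * S).
Proof.
rewrite !retrE !LGME LGadjP LGadj_delta -ip_l2J l2JK -LGadj_delta.
by rewrite ipC -LGadjP.
Qed.

Lemma LGadj_uniq S T : (forall x y, ip (S x) y = ip x (T y)) -> LGadj S = T.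
Proof. by move=> e; apply: LGP => y; apply: ip_inj => z; rewrite -e -LGadjP. Qed.

Lemma LGadjK T : LGadj (LGadj T) = T.
Proof. by apply: LGadj_uniq => x y; rewrite LGadjPr. Qed.

Lemma retr_adj_ge0 T : 0 <= retr (T * LGadj T).
Proof. by rewrite retrE LGME LGadjP ipxx sqn_ge0. Qed.

(** Linearity, the norm bound 1 and commutation with each bounded S of the commutant all survive
    pointwise limits. *)
Lemma LG_strong_limit (X : nat -> LGt) :
  (forall n x, sqn (X n x) <= sqn x) ->
  (forall x, sqn_cauchy (fun n => X n x)) ->
  exists P : LGt, forall x, sqn_cvg (fun n => X n x) (P x).
Proof.
move=> Xle Xc.
have [x|P PE] := @choice _ _ (fun x y : H => sqn_cvg (fun n => X n x) y).
  exact: l2_complete.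
suff PP : P \in LG_pred (R := R) (G := G) by exists (MkLG PP).
have BL S : {morph S : x y / x - y} by move=> x y; rewrite LGfD LGfN.
apply/asboolP; split; [apply/bounded_opP; split|].
- move=> a x y; apply: (sqn_cvg_uniq (PE _)).
  apply: (@eq_sqn_cvg _ _ (fun n => a *: X n x + X n y)) => [n|].
    by rewrite LG_linear.
  apply: sqn_cvgD => //; apply: (@sqn_cvg_op _ _ (fun x => a *: x) (sqnormc a)) => //.
  + by move=> z w; rewrite scalerBr.
  + by move=> z; rewrite sqnZ.
- exists 1 => // x; rewrite mul1r; apply: sqn_cvg_le (PE x) => n; exact: Xle.
- move=> S cS x; apply: (sqn_cvg_uniq (PE _)).
  have [linS [M _ SM]] := (bounded_opP S).1 cS.1.
  apply: (@eq_sqn_cvg _ _ (fun n => S (X n x))) => [n|]; first by rewrite LG_comm.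
  apply: (sqn_cvg_op _ SM) => // z w.
  by rewrite -scaleN1r addrC linS addrC scaleN1r.
Qed.

End GroupVN.

(** * Matrices over the group von Neumann algebra *)

Section MatrixAction.
Context (R : realType) (G : groupType).
Local Notation H := (l2 R G).
Local Notation LGt := (LG R G).

Lemma LGadjD (S T : LGt) : LGadj (S + T) = LGadj S + LGadj T.
Proof. by apply: LGadj_uniq => x y; rewrite !LGDE ipDl ipDr !LGadjP. Qed.
Lemma LGadj0 : LGadj (0 : LGt) = 0.
Proof. by apply: LGadj_uniq => x y; rewrite !LG0E ip0l ip0r. Qed.
Lemma LGadjN (T : LGt) : LGadj (- T) = - LGadj T.
Proof. by apply: LGadj_uniq => x y; rewrite !LGNE ipNl ipNr LGadjP. Qed.
Lemma LGadj1 : LGadj (1 : LGt) = 1.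
Proof. by apply: LGadj_uniq => x y; rewrite !LG1E. Qed.
Lemma LGadjM (S T : LGt) : LGadj (S * T) = LGadj T * LGadj S.
Proof. by apply: LGadj_uniq => x y; rewrite !LGME !LGadjP. Qed.
Lemma LGadj_sum (I : Type) (s : seq I) (F : I -> LGt) :
  LGadj (\sum_(i <- s) F i) = \sum_(i <- s) LGadj (F i).
Proof. exact: (big_morph (@LGadj R G) LGadjD LGadj0). Qed.

Definition vsqn n (x : 'I_n -> H) : R := \sum_i sqn (x i).
Definition vip n (x y : 'I_n -> H) : R := \sum_i ip (x i) (y i).
Definition vsub n (x y : 'I_n -> H) (i : 'I_n) : H := x i - y i.
Definition vsingle n (j : 'I_n) (x : H) (i : 'I_n) : H := if i == j then x else 0.

Definition mact m n (X : 'M[LGt]_(m, n)) (x : 'I_n -> H) (i : 'I_m) : H :=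
  \sum_j X i j (x j).
Definition madj m n (X : 'M[LGt]_(m, n)) : 'M[LGt]_(n, m) :=
  \matrix_(i, j) LGadj (X j i).
Definition mtr n (X : 'M[LGt]_n) : R := \sum_i retr (X i i).

Lemma vipC n (x y : 'I_n -> H) : vip x y = vip y x.
Proof. by apply: eq_bigr => i _; exact: ipC. Qed.

Lemma vsqn_ge0 n (x : 'I_n -> H) : 0 <= vsqn x.
Proof. by apply: sumr_ge0 => i _; exact: sqn_ge0. Qed.

Lemma sqn_le_vsqn n (x : 'I_n -> H) i : sqn (x i) <= vsqn x.
Proof. by rewrite /vsqn (bigD1 i) //= lerDl sumr_ge0 // => j _; exact: sqn_ge0. Qed.

Lemma vsqn_eq0 n (x : 'I_n -> H) : vsqn x = 0 -> forall i, x i = 0.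
Proof.
by move=> x0 i; apply/sqn_eq0/le_anti; rewrite sqn_ge0 andbT -x0 sqn_le_vsqn.
Qed.

Lemma vsqn_sub n (x y : 'I_n -> H) : vsqn (vsub x y) = vsqn x + vsqn y - 2 * vip x y.
Proof.
rewrite /vsqn /vip mulr_sumr -sumrN -!big_split /=.
by apply: eq_bigr => i _; rewrite -sqnB.
Qed.

Lemma vsqn_single n (j : 'I_n) x : vsqn (vsingle j x) = sqn x.
Proof.
rewrite /vsqn (bigD1 j) //= /vsingle eqxx big1 ?addr0 // => i /negPf ->.
exact: sqn0.
Qed.

Lemma mact_single m n (X : 'M[LGt]_(m, n)) j x i : mact X (vsingle j x) i = X i j x.
Proof.
rewrite /mact (bigD1 j) //= /vsingle eqxx big1 ?addr0 // => k /negPf ->.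
exact: LGf0.
Qed.

Lemma mactM m n p (X : 'M[LGt]_(m, n)) (Y : 'M[LGt]_(n, p)) x :
  mact (X *m Y) x = mact X (mact Y x).
Proof.
apply/funext => i; rewrite /mact.
under [RHS]eq_bigr do rewrite LGf_sum.
rewrite exchange_big; apply: eq_bigr => j _ /=.
by rewrite mxE LG_sumE.
Qed.

Lemma mact1 n (x : 'I_n -> H) : mact 1%:M x = x.
Proof.
apply/funext => i; rewrite /mact (bigD1 i) //= mxE eqxx big1 ?addr0 // => j.
by rewrite mxE eq_sym => /negPf ->.
Qed.

Lemma mactB m n (X Y : 'M[LGt]_(m, n)) x : mact (X - Y) x = vsub (mact X x) (mact Y x).
Proof.
apply/funext => i; rewrite /vsub /mact -sumrB; apply: eq_bigr => j _.
by rewrite !mxE.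
Qed.

Lemma mact_inj m n (X Y : 'M[LGt]_(m, n)) : (forall x, mact X x = mact Y x) -> X = Y.
Proof.
by move=> e; apply/matrixP => i j; apply: LGP => x; rewrite -!mact_single e.
Qed.

Lemma vip_mact m n (X : 'M[LGt]_(m, n)) x y : vip (mact X x) y = vip x (mact (madj X) y).
Proof.
rewrite /vip; transitivity (\sum_i \sum_j ip (X i j (x j)) (y i)).
  apply: eq_bigr => i _.
  exact: (big_morph (fun z => ip z (y i)) (fun z w => ipDl z w (y i)) (ip0l (y i))).
rewrite exchange_big; apply: eq_bigr => j _ /=.
rewrite [RHS](big_morph (ip (x j)) (ipDr (x j)) (ip0r (x j))).
by apply: eq_bigr => i _; rewrite mxE LGadjP.
Qed.

Lemma madjK m n (X : 'M[LGt]_(m, n)) : madj (madj X) = X.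
Proof. by apply/matrixP => i j; rewrite !mxE LGadjK. Qed.

Lemma madjM m n p (X : 'M[LGt]_(m, n)) (Y : 'M[LGt]_(n, p)) :
  madj (X *m Y) = madj Y *m madj X.
Proof.
apply/matrixP => i j; rewrite !mxE LGadj_sum; apply: eq_bigr => k _.
by rewrite LGadjM !mxE.
Qed.

Lemma madjB m n (X Y : 'M[LGt]_(m, n)) : madj (X - Y) = madj X - madj Y.
Proof. by apply/matrixP => i j; rewrite !mxE LGadjD LGadjN. Qed.

Lemma madj1 n : madj (1%:M : 'M[LGt]_n) = 1%:M.
Proof.
by apply/matrixP => i j; rewrite !mxE eq_sym; case: eqP; rewrite ?LGadj1 ?LGadj0.
Qed.

Lemma madj0 m n : madj (0 : 'M[LGt]_(m, n)) = 0.
Proof. by apply/matrixP => i j; rewrite !mxE LGadj0. Qed.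

Lemma mtrB n (X Y : 'M[LGt]_n) : mtr (X - Y) = mtr X - mtr Y.
Proof.
by rewrite /mtr -sumrB; apply: eq_bigr => i _; rewrite !mxE retrD retrN.
Qed.

Lemma mtr1 n : mtr (1%:M : 'M[LGt]_n) = n%:R.
Proof.
rewrite /mtr (eq_bigr (fun=> 1)) ?sumr_const ?card_ord // => i _.
by rewrite mxE eqxx retr1.
Qed.

Lemma mtrM m n (X : 'M[LGt]_(m, n)) (Y : 'M[LGt]_(n, m)) : mtr (X *m Y) = mtr (Y *m X).
Proof.
rewrite /mtr; transitivity (\sum_i \sum_j retr (X i j * Y j i)).
  by apply: eq_bigr => i _; rewrite mxE retr_sum.
rewrite exchange_big; apply: eq_bigr => j _ /=.
by rewrite mxE retr_sum; apply: eq_bigr => i _; exact: retrM.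
Qed.

Lemma mtr_adj_ge0 n (X : 'M[LGt]_n) : 0 <= mtr (X *m madj X).
Proof.
apply: sumr_ge0 => i _; rewrite mxE retr_sum; apply: sumr_ge0 => j _.
by rewrite mxE retr_adj_ge0.
Qed.

(** The crude constant comes from iterating [sqnD_le]; only boundedness of matrices is drawn from
    it. *)
Lemma sqn_sum_le (I : Type) (s : seq I) (x : I -> H) :
  sqn (\sum_(i <- s) x i) <= 2 ^+ size s * \sum_(i <- s) sqn (x i).
Proof.
elim: s => [|i s IH]; first by rewrite !big_nil sqn0 mulr0.
rewrite !big_cons /= exprS; apply: le_trans (sqnD_le _ _) _.
rewrite -mulrA -mulrDr ler_pM2l // mulrDr lerD //.
by rewrite ler_peMl ?sqn_ge0 // exprn_ege1 // ler1n.
Qed.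

Lemma mact_bounded m n (X : 'M[LGt]_(m, n)) :
  exists2 M : R, 0 <= M & forall x, vsqn (mact X x) <= M * vsqn x.
Proof.
have [[i j]|N hN] := @choice _ _ (fun (ij : 'I_m * 'I_n) (M : R) =>
    0 <= M /\ forall x, sqn (X ij.1 ij.2 x) <= M * sqn x).
  by have [M M0 hM] := LG_sqn (X i j); exists M.
exists (\sum_i 2 ^+ size (index_enum 'I_n) * \sum_j N (i, j)).
  apply: sumr_ge0 => i _; rewrite mulr_ge0 ?exprn_ge0 // sumr_ge0 // => j _.
  by have [] := hN (i, j).
move=> x; rewrite mulr_suml; apply: ler_sum => i _.
apply: le_trans (sqn_sum_le _ _) _.
rewrite -mulrA ler_pM2l ?exprn_gt0 // mulr_suml; apply: ler_sum => j _.
have [N0 hj] := hN (i, j); apply: le_trans (hj _) _.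
by rewrite ler_wpM2l // sqn_le_vsqn.
Qed.

Fact LGscal_subproof (c : R) : (fun x : H => c%:C%C *: x) \in LG_pred (R := R) (G := G).
Proof.
apply/asboolP; split; last first.
  by move=> S [[linS _] _] x; have := linS c%:C%C x 0; rewrite (linear0_op linS) !addr0 => ->.
apply/bounded_opP; split; first by move=> a x y; rewrite scalerDr !scalerA mulrC.
by exists (sqnormc c%:C%C) => [|x]; rewrite ?sqnormc_ge0 // sqnZ.
Qed.

(** Real scalars inside LG, with which a bounded matrix is rescaled to a contraction. *)
Definition LGscal c : LGt := MkLG (LGscal_subproof c).

End MatrixAction.

(** * Projection onto the left kernel of a contraction *)

Section KernelProjection.
Context (R : realType) (G : groupType).
Local Notation H := (l2 R G).
Local Notation LGt := (LG R G).
Context (m k : nat) (T : 'M[LGt]_(m, k)).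
Hypothesis Tle : forall x, vsqn (mact T x) <= vsqn x.

Let C : 'M[LGt]_m := 1%:M - T *m madj T.
Let C' : 'M[LGt]_k := 1%:M - madj T *m T.

Let adjC : madj C = C.
Proof. by rewrite /C madjB madj1 madjM madjK. Qed.

Let adjC' : madj C' = C'.
Proof. by rewrite /C' madjB madj1 madjM madjK. Qed.

(** With y the image of x under the adjoint of T, expanding gives |x|^2 + |Ty|^2 - 2|y|^2, and |Ty|
    <= |y|. So C is a contraction that preserves only norms of vectors killed by the adjoint. *)
Let C_contr x : vsqn (mact C x) <= vsqn x - vsqn (mact (madj T) x).
Proof.
rewrite /C mactB mact1 mactM vsqn_sub; set y := mact (madj T) x.
have -> : vip x (mact T y) = vsqn y.
  rewrite -[T in LHS]madjK -vip_mact /vip /vsqn.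
  by apply: eq_bigr => i _; exact: ipxx.
have := Tle y; move: (vsqn _) (vsqn _) (vsqn _) => a b c; lra.
Qed.

Let vip_expC j x y : vip (mact (C ^+ j) x) y = vip x (mact (C ^+ j) y).
Proof.
elim: j x y => [|j IH] x y; first by rewrite expr0 !mact1.
by rewrite {1}exprSr exprS !mactM IH vip_mact adjC.
Qed.

Let q x j := vsqn (mact (C ^+ j) x).

Let q_le x i j : (i <= j)%N -> q x j <= q x i.
Proof.
move=> /subnK <-; elim: (j - i)%N => // n IH; rewrite addSn.
apply: le_trans IH; rewrite /q exprS mactM; apply: le_trans (C_contr _) _.
by rewrite gerBl vsqn_ge0.
Qed.

(** Even exponents let the self-adjoint C be distributed equally over both sides, which makes the
    inner product a squared norm. *)
Let vip_even x i j : vip (mact (C ^+ i.*2) x) (mact (C ^+ j.*2) x) = q x (i + j).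
Proof.
rewrite /q /vsqn; transitivity (vip (mact (C ^+ (i + j)) x) (mact (C ^+ (i + j)) x)).
  rewrite !vip_expC -!mactM !mulmxE -!exprD.
  by rewrite -!addnn addnACA.
by apply: eq_bigr => l _; rewrite ipxx.
Qed.

(** The squared distance is q(2i) + q(2j) - 2 q(i+j), and the nonincreasing, nonnegative sequence q
    converges. *)
Let q_cauchy x e : 0 < e -> exists N, forall i j, (N <= i)%N -> (N <= j)%N ->
  vsqn (vsub (mact (C ^+ i.*2) x) (mact (C ^+ j.*2) x)) <= e.
Proof.
move=> e0.
have qc : cvgn (q x).
  apply: nonincreasing_is_cvgn; first by move=> i j; exact: q_le.
  by exists 0 => _ [i _ <-]; exact: vsqn_ge0.
have lq n : limn (q x) <= q x n.
  by apply: nonincreasing_cvgn_ge => // i j; exact: q_le.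
have [N _ hN] := (cvgrPdist_le (q x) _).1 qc (e / 2) (divr_gt0 e0 (ltr0Sn _ 1)).
exists N => i j Ni Nj; rewrite vsqn_sub vip_even -!/(q _ _).
have h l : (N <= l)%N -> q x l <= limn (q x) + e / 2.
  move=> Nl; have := hN l Nl; rewrite ler_norml => /andP[+ _].
  by move: (limn _) (q x l) => a b; lra.
have := h i.*2; have := h j.*2; have := lq (i + j)%N.
have -> : (N <= i.*2)%N by rewrite -addnn (leq_trans Ni) ?leq_addr.
have -> : (N <= j.*2)%N by rewrite -addnn (leq_trans Nj) ?leq_addr.
move: (limn _) (q _ _) (q _ _) (q _ _) => a b c d h1 /(_ isT) h2 /(_ isT) h3; lra.
Qed.

(* The projection is the strong limit of [C ^+ n.*2]. *)
Lemma kernel_projection : exists P : 'M[LGt]_m,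
  [/\ P *m T = 0, (forall B : 'M[LGt]_m, B *m T = 0 -> B *m P = B)
    & m%:R - k%:R <= mtr P].
Proof.
have Xle (ij : 'I_m * 'I_m) n x : sqn ((C ^+ n.*2) ij.1 ij.2 x) <= sqn x.
  rewrite -mact_single; apply: le_trans (sqn_le_vsqn _ _) _.
  rewrite -(vsqn_single ij.2 x); apply: le_trans (q_le _ (leq0n _)) _.
  by rewrite /q expr0 mact1.
have Xc (ij : 'I_m * 'I_m) x : sqn_cauchy (fun n => (C ^+ n.*2) ij.1 ij.2 x).
  move=> e e0; have [N hN] := q_cauchy (vsingle ij.2 x) e0.
  exists N => i j Ni Nj; apply: le_trans (hN i j Ni Nj).
  by rewrite -!mact_single; exact: (sqn_le_vsqn (vsub _ _)).
have [ij|P0 hP0] := @choice _ _ (fun (ij : 'I_m * 'I_m) (P : LGt) =>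
    forall x, sqn_cvg (fun n => (C ^+ n.*2) ij.1 ij.2 x) (P x)).
  exact: LG_strong_limit (Xle ij) (Xc ij).
pose P : 'M[LGt]_m := \matrix_(i, j) P0 (i, j).
have cP x i : sqn_cvg (fun n => mact (C ^+ n.*2) x i) (mact P x i).
  apply: sqn_cvg_sum => j; rewrite mxE; exact: (hP0 (i, j)).
have cPl l (B : 'M[LGt]_(l, m)) x i :
    sqn_cvg (fun n => mact B (mact (C ^+ n.*2) x) i) (mact B (mact P x) i).
  apply: sqn_cvg_sum => j; have [M _ hM] := LG_sqn (B i j).
  by apply: sqn_cvg_op hM (cP x j) => y z; rewrite LGfD LGfN.
(* Both sides are strong limits of the same sequence, shifted by one index on the left. *)
have CCP : C *m C *m P = P.
  apply: mact_inj => x; apply/funext => i; rewrite mactM.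
  apply: sqn_cvg_uniq (cPl _ _ x i) _ => e e0; have [N hN] := cP x i e e0.
  exists N => n Nn; rewrite -!mactM mulmxE -mulrA -!exprS.
  by apply: (hN n.+1); rewrite leqW.
(* A vector y in the range of P is fixed by C C, so applying C loses no norm, and [C_contr] forces
   the adjoint of T to kill y. *)
have TP : madj T *m P = 0.
  apply: mact_inj => x; rewrite mactM; set y := mact P x.
  have y0 : vsqn (mact (madj T) y) = 0.
    apply/le_anti; rewrite vsqn_ge0 andbT.
    have CCy : mact C (mact C y) = y by rewrite /y -!mactM CCP.
    have := C_contr y; have := C_contr (mact C y); rewrite CCy.
    have := vsqn_ge0 (mact (madj T) (mact C y)).
    move: (vsqn (mact (madj T) (mact C y))) (vsqn (mact (madj T) y)) (vsqn y) (vsqn _).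
    by move=> a b c d; lra.
  apply/funext => i; rewrite (vsqn_eq0 y0).
  by rewrite /mact big1 // => j _; rewrite mxE.
(* P is a limit of self-adjoint powers; this turns [madj T *m P = 0] into [P *m T = 0]. *)
have adjP : madj P = P.
  apply: mact_inj => y; apply/funext => i; apply: ip_inj => z.
  have ipE (X : 'M[LGt]_m) : ip z (mact X y i) = vip (vsingle i z) (mact X y).
    rewrite /vip (bigD1 i) //= /vsingle eqxx big1 ?addr0 // => j /negPf ->.
    exact: ip0l.
  rewrite !ipE -vip_mact; set w := vsingle i z.
  have c1 : vip (mact (C ^+ n.*2) w) y @[n --> \oo] --> vip (mact P w) y.
    by apply: cvg_sumr => j; apply: sqn_cvg_ip; exact: cP.
  have c2 : vip (mact (C ^+ n.*2) w) y @[n --> \oo] --> vip w (mact P y).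
    under eq_fun do rewrite vip_expC vipC.
    rewrite vipC.
    by apply: cvg_sumr => j; apply: sqn_cvg_ip; exact: cP.
  rewrite -(cvg_lim (@Rhausdorff R) c1).
  exact: (cvg_lim (@Rhausdorff R) c2).
exists P; split.
- by rewrite -[T]madjK -adjP -madjM TP madj0.
- move=> B BT; have BC n : B *m C ^+ n = B.
    elim: n => [|n IH]; first by rewrite expr0 mulmx1.
    rewrite exprS -mulmxE mulmxA.
    by rewrite {1}/C mulmxBr mulmx1 mulmxA BT mul0mx subr0 IH.
  apply: mact_inj => x; apply/funext => i; rewrite mactM.
  apply: sqn_cvg_uniq (cPl _ _ x i) _ => e e0; exists 0%N => n _.
  by rewrite -mactM BC subrr sqn0 ltW.
(* Since C T = T C', the trace property shows that both traces drop by the same amount at each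
   step. *)
have tr j : mtr (C ^+ j) - m%:R = mtr (C' ^+ j) - k%:R.
  have CT n : C ^+ n *m T = T *m C' ^+ n.
    elim: n => [|n IH]; first by rewrite !expr0 mulmx1 mul1mx.
    have CT1 : C *m T = T *m C' by rewrite mulmxBl mulmxBr mul1mx mulmx1 mulmxA.
    by rewrite !exprSr -!mulmxE -mulmxA CT1 mulmxA IH mulmxA.
  elim: j => [|j IH]; first by rewrite !expr0 !mtr1 !subrr.
  rewrite !exprSr -!mulmxE {2}/C {2}/C' !mulmxBr !mulmx1 !mtrB.
  rewrite mulmxA CT -mulmxA [mtr (T *m _)]mtrM -mulmxA.
  by move: IH; move: (mtr _) (mtr _) (mtr _) (m%:R) (k%:R) => a b c d e; lra.
(* The even power of the self-adjoint C' has the form Y Y*, hence nonnegative trace. *)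
have trge n : m%:R - k%:R <= mtr (C ^+ n.*2).
  have : 0 <= mtr (C' ^+ n.*2).
    rewrite -addnn exprD -mulmxE -{2}(_ : madj (C' ^+ n) = C' ^+ n) ?mtr_adj_ge0 //.
    elim: n => [|n IH]; first by rewrite expr0 madj1.
    by rewrite {1}exprS -mulmxE madjM IH adjC' exprSr.
  by move: (tr n.*2); move: (mtr _) (mtr _) (m%:R) (k%:R) => a b c d; lra.
apply: (@ler_cvg_to _ \oo _ _ (fun=> m%:R - k%:R) (fun n => mtr (C ^+ n.*2))).
- exact: cvg_cst.
- apply: cvg_sumr => i; rewrite retrE; under eq_fun do rewrite retrE.
  by apply: sqn_cvg_ip; rewrite mxE; exact: (hP0 (i, i)).
- by exists 0%N.
Qed.

End KernelProjection.

Section Kernel.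
Context (R : realType) (G : groupType).
Local Notation LGt := (LG R G).

(** With P the projection onto the left kernel of E N, any row of P E satisfies both equations; the
    trace bound on P shows that some row is nonzero. *)
Lemma idempotent_kernel (m k : nat) (E : 'M[LGt]_m) (N : 'M[LGt]_(m, k)) :
  E *m E = E -> k%:R < mtr E ->
  exists v : 'rV[LGt]_m, [/\ v != 0, v *m E = v & v *m N = 0].
Proof.
move=> EE trE.
have [M M0 hM] := mact_bounded (E *m N).
(* This scale makes T a contraction: both M c and c are at most 1, hence so is M c^2. *)
pose c := (M + 1)^-1; have M1 : 0 < M + 1 by rewrite ltr_wpDl.
have c1 : c <= 1 by rewrite invf_le1 // lerDr.
pose T := E *m N *m (LGscal G c)%:M.
have scalE n (a : R) (x : 'I_n -> l2 R G) i : mact ((LGscal G a)%:M) x i = a%:C%C *: x i.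
  rewrite /mact (bigD1 i) //= mxE eqxx big1 ?addr0 // => j.
  by rewrite mxE eq_sym => /negPf ->.
have Tle x : vsqn (mact T x) <= vsqn x.
  rewrite /T mactM; apply: le_trans (hM _) _.
  rewrite (_ : vsqn _ = c ^+ 2 * vsqn x); last first.
    rewrite mulr_sumr; apply: eq_bigr => i _; rewrite scalE sqnZ.
    by rewrite /sqnormc /= expr0n addr0.
  rewrite mulrA ler_piMl ?vsqn_ge0 // expr2 mulrA mulr_ile1 //.
  - by rewrite mulr_ge0 // invr_ge0 ltW.
  - by rewrite invr_ge0 ltW.
  - by rewrite ler_pdivrMr // mul1r lerDl.
have [P [PT hP trP]] := kernel_projection Tle.
have FP : (1%:M - E) *m P = 1%:M - E.
  by apply: hP; rewrite /T !mulmxA mulmxBl mul1mx EE subrr !mul0mx.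
have PEN : P *m (E *m N) = 0.
  have cK : LGscal G c * LGscal G (M + 1) = 1 :> LGt.
    apply: LGP => x; rewrite LGME LG1E /= scalerA -rmorphM mulVf ?gt_eqF //.
    by rewrite rmorph1 scale1r.
  have := congr1 (mulmx^~ (LGscal G (M + 1))%:M) PT.
  by rewrite /T /= mul0mx !mulmxA -mulmxA -scalar_mxM cK mulmx1.
(* Otherwise P and 1 - E, being equal to (1 - E) P, would have the same trace, namely m minus that
   of E, which is below m - k. *)
have PE0 : P *m E != 0.
  apply/eqP => PE.
  have : mtr P = mtr (1%:M - E).
    by rewrite -[in RHS]FP mtrM mulmxBr mulmx1 PE subr0.
  by rewrite mtrB mtr1 => e; move: trP trE; rewrite e lerD2l lerN2 leNgt => /negP h /h.
have [i /eqP/rowP hi] : exists i, row i (P *m E) != 0.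
  apply/existsP; apply: contraNT PE0; rewrite negb_exists => /forallP h.
  by apply/eqP/row_matrixP => i; rewrite row0; apply/eqP; have := h i; rewrite negbK.
exists (row i (P *m E)); split.
- by apply/eqP => e; apply: hi => j; rewrite e.
- by rewrite -row_mul -mulmxA EE.
- by rewrite -row_mul -mulmxA PEN row0.
Qed.

End Kernel.

(** * The group ring *)

Section FinSuppSums.

Lemma additive_mulrz (U V : zmodType) (f : U -> V) : {morph f : x y / x + y} ->
  forall x (n : int), f (x *~ n) = f x *~ n.
Proof.
move=> fD x n; have f0 : f 0 = 0 by apply: (addIr (f 0)); rewrite -fD !add0r.
have fN y : f (- y) = - f y by apply: (addIr (f y)); rewrite -fD !addNr.
have fn y m : f (y *+ m) = f y *+ m.
  by elim: m => [|m IH]; rewrite ?mulr0n // !mulrS fD IH.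
by case: n => m; rewrite ?NegzE ?mulrNz ?fN -?pmulrn fn.
Qed.

Context (A : pzRingType) (K : choiceType) (V : lmodType A).
Implicit Types c d : finsupp_fun K V.

Lemma finsupp_enum c : exists2 s : seq K, uniq s & forall k, k \notin s -> c k = 0.
Proof.
exists (fset_set [set k | c k != 0]); first exact: fset_uniq.
move=> k; rewrite in_fset_set; last exact: finsupp_finite.
by move=> /negP h; apply/eqP; apply: contra_notT h; rewrite inE.
Qed.

Lemma finsupp_add c d k : (c + d) k = c k + d k. Proof. by []. Qed.

Lemma finsupp_sum (I : Type) (s : seq I) (F : I -> finsupp_fun K V) k :
  (\sum_(i <- s) F i) k = \sum_(i <- s) F i k.
Proof. by elim/big_rec2: _ => // i y c _ <-. Qed.

Lemma finsupp_decomp c (s : seq K) : uniq s -> (forall k, k \notin s -> c k = 0) ->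
  c = \sum_(k <- s) fs_single k (c k).
Proof.
move=> us c0; apply: Defs.finsuppP => k; rewrite finsupp_sum /=.
have [ks|ks] := boolP (k \in s); last first.
  rewrite c0 // big_seq big1 // => i iss.
  by case: eqP => // e; rewrite e iss in ks.
rewrite (bigD1_seq k) //= eqxx big1 ?addr0 // => i /negPf.
by rewrite eq_sym => ->.
Qed.

Lemma fs_liftE (W : zmodType) (F : K -> V -> W) c (s : seq K) :
  (forall k, F k 0 = 0) -> uniq s -> (forall k, k \notin s -> c k = 0) ->
  fs_lift F c = \sum_(k <- s) F k (c k).
Proof.
move=> F0 us c0; rewrite /fs_lift -(fsbig_widen [set` s]) //; last first.
  by move=> k [_ /= /negP ks] /=; rewrite c0.
by rewrite -fsbig_seq.
Qed.

Lemma fs_liftD (W : zmodType) (F : K -> V -> W) :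
  (forall k, {morph F k : x y / x + y}) -> {morph fs_lift F : c d / c + d}.
Proof.
move=> FD c d.
have F0 k : F k 0 = 0 by apply: (addIr (F k 0)); rewrite -FD !add0r.
have [s us c0] := finsupp_enum c; have [t ut d0] := finsupp_enum d.
pose u := undup (s ++ t); have uu : uniq u by exact: undup_uniq.
have uP k : k \notin u -> (k \notin s) && (k \notin t).
  by rewrite mem_undup mem_cat negb_or.
rewrite !(@fs_liftE _ _ _ u) // => [|k /uP/andP[_ /d0] //|k /uP/andP[/c0] //|].
  by rewrite -big_split; apply: eq_bigr => k _; rewrite finsupp_add FD.
by move=> k /uP/andP[/c0 e1 /d0 e2]; rewrite finsupp_add e1 e2 addr0.
Qed.

Lemma fs_single0 (k : K) : fs_single (A := A) k (0 : V) = 0.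
Proof. by apply: Defs.finsuppP => k' /=; case: eqP. Qed.

Lemma fs_singleZ (k : K) a (v : V) : fs_single k (a *: v) = a *: fs_single k v.
Proof.
by have := fs_single_is_linear (A := A) k a v 0; rewrite fs_single0 !addr0.
Qed.

End FinSuppSums.

Section GroupRing.
Context (R : realType) (G : groupType).
Local Notation LGt := (LG R G).

Definition zgLG (a : ZG G) : LGt := fs_lift (fun g (n : int^o) => LGu R g *~ n) a.

Lemma zgLGD : {morph zgLG : a b / a + b}.
Proof. by apply: fs_liftD => g n m; rewrite mulrzDr. Qed.

Lemma zgLG0 : zgLG 0 = 0.
Proof. by apply: (addIr (zgLG 0)); rewrite -zgLGD !add0r. Qed.

Lemma zgLG_single g (n : int) : zgLG (fs_single g (n : int^o)) = LGu R g *~ n.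
Proof. by rewrite /zgLG fs_lift_single // => k; rewrite mulr0z. Qed.

Lemma LGu_delta (g : G) : LGu R g (l2delta R 1%g) = l2delta R g.
Proof. by apply: l2P => h /=; rewrite mulg_eq1 eqg_inv eq_sym. Qed.

(* Right multiplication by [a] becomes, under the antiunitary [l2J], the left action
   of the element [g |-> a g^-1]. *)
Lemma zgLG_cancelr (a : ZG G) (c : LGt) :
  (forall b : ZG G, b != 0 -> injective (fun x : l2 R G => ZG_act b x)) ->
  a != 0 -> c * zgLG a = 0 -> c = 0.
Proof.
move=> inj a0 ca0; have [s us sP] := finsupp_enum a.
have a'P : (fun g => a g^-1%g) \in fin_supp (K := G) (V := int^o).
  apply/asboolP; apply: (@sub_finite_set _ _ ((fun g => g^-1%g) @` [set g | a g != 0])).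
    by move=> g /= ag; exists g^-1%g => //; rewrite invgK.
  by apply: finite_image; exact: finsupp_finite.
pose a' : ZG G := FinSuppFun a'P.
have a'0 : a' != 0.
  apply: contraNneq a0 => e; apply/eqP/Defs.finsuppP => g.
  by rewrite -[g]invgK -[LHS]/(a' g^-1%g) e.
(* Applying [c * zgLG a = 0] to delta_e and then [l2J] says that [a'] annihilates this vector, which
   therefore vanishes. *)
pose x := l2J (c (l2delta R 1%g)).
have act0 : ZG_act a' x = 0.
  have -> : ZG_act a' x = \sum_(g <- map (fun g => g^-1%g) s) lreg g x *~ a' g.
    apply: fs_liftE => [k||k ks]; first by rewrite mulr0z.
      by rewrite map_inj_uniq //; exact: invg_inj.
    apply: sP; apply: contraNN ks => ks; apply/mapP; exists k^-1%g => //.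
    by rewrite invgK.
  rewrite big_map /= (eq_bigr (fun g => l2J ((c * LGu R g) (l2delta R 1%g) *~ a g))).
    transitivity (l2J ((c * zgLG a) (l2delta R 1%g))); last first.
      by rewrite ca0 LG0E l2J0.
    rewrite /zgLG (@fs_liftE _ _ _ _ _ _ s) //.
    rewrite LGME LG_sumE LGf_sum.
    rewrite (big_morph (@l2J R G) (@l2JD R G) (l2J0 R G)).
    apply: eq_bigr => g _; congr l2J.
    rewrite (additive_mulrz (f := fun T : LGt => T (l2delta R 1%g))) //.
    by rewrite (additive_mulrz (f := c)) //; exact: LGfD.
  move=> g _; rewrite invgK (additive_mulrz (@l2JD R G)); congr (_ *~ _).
  apply: l2P => h; rewrite LGME LGu_delta /= /conjinv LG_deltaE.
  by rewrite invgK invgM.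
have x0 : x = 0.
  apply: (inj a' a'0); rewrite act0; apply/esym.
  have [s' us' sP'] := finsupp_enum a'.
  rewrite /ZG_act (fs_liftE _ us' sP'); last by move=> k; rewrite mulr0z.
  rewrite big1 // => g _; rewrite (_ : lreg g 0 = 0) ?mul0rz //.
  exact: linear0_op (@lreg_linear R G g).
have cd : c (l2delta R 1%g) = 0.
  by rewrite -[LHS]l2JK -/x x0 l2J0.
apply: LG_delta_inj => g; apply: l2P => h.
by rewrite LG_deltaE cd.
Qed.

End GroupRing.

(** * The first homology *)

Section ChainsModBoundaries.
Context (R : realType) (G : groupType).
Local Notation LGt := (LG R G).
Local Notation C0 := (chains0 R G).
Local Notation C1 := (chains1 R G).
Local Notation C2 := (chains2 R G).

Definition bd2_image : {pred C1} := fun c => `[< exists b : C2, bd2 b = c >].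

Lemma bd2_image_submod_closed : submod_closed bd2_image.
Proof.
split.
  apply/asboolP; exists 0.
  by have := @bd2_linear R G (-1) 0 0; rewrite scaleN1r addr0 oppr0 scaleN1r addNr.
move=> a x y /asboolP[b bx] /asboolP[c cy]; apply/asboolP.
by exists (a *: b + c); rewrite bd2_linear bx cy.
Qed.

HB.instance Definition _ :=
  GRing.isSubmodClosed.Build LGt C1 bd2_image bd2_image_submod_closed.

(** All 1-chains, not only cycles, are taken modulo boundaries: the class of a single bar [g] makes
    sense here, and a cycle has zero class exactly when it is a boundary. *)
Definition C1_mod_bd : lmodType LGt := quot_lmod bd2_image.

Definition chain_class (c : C1) : C1_mod_bd := quot_pi bd2_image c.

Definition bar1 (g : G) : C1_mod_bd := chain_class (fs_single (V := C0) g (1 : LGt)).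

Lemma chain_classD : {morph chain_class : x y / x + y}.
Proof. exact: quot_piD. Qed.
Lemma chain_classZ a c : chain_class (a *: c) = a *: chain_class c.
Proof. by apply/esym; exact: quot_piZ. Qed.
Lemma chain_class0 : chain_class 0 = 0.
Proof. by rewrite -(scale0r 0) chain_classZ scale0r. Qed.
Lemma chain_class_sum (I : Type) (s : seq I) (F : I -> C1) :
  chain_class (\sum_(i <- s) F i) = \sum_(i <- s) chain_class (F i).
Proof. exact: (big_morph chain_class chain_classD chain_class0). Qed.

Lemma chain_classP c : chain_class c = 0 <-> exists b : C2, bd2 b = c.
Proof.
rewrite -chain_class0; split=> [/quot_piE|bc].
  by rewrite subr0 => /asboolP.
by apply/quot_piE; rewrite subr0; apply/asboolP.
Qed.

Lemma bd1D : {morph @bd1 R G : x y / x + y}.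
Proof. by move=> x y; have := @bd1_linear R G 1 x y; rewrite !scale1r. Qed.
Lemma bd1_0 : bd1 0 = 0 :> C0.
Proof. by apply: (addIr (bd1 0)); rewrite -bd1D !add0r. Qed.
Lemma bd1Z (a : LGt) (c : C1) : bd1 (a *: c) = a * (bd1 c : LGt).
Proof. by have := @bd1_linear R G a c 0; rewrite bd1_0 !addr0. Qed.

Lemma bd1_single g (a : LGt) : bd1 (fs_single (V := C0) g a) = a * LGu R g - a.
Proof. by apply: fs_lift_single => k; rewrite mul0r subr0. Qed.

Definition class_bd (v : C1_mod_bd) : LGt := bd1 (repr (v : Quotient.quot (submod_pred bd2_image))).

(** The choice of representative is harmless because [bd1] kills boundaries. *)
Lemma class_bdE c : class_bd (chain_class c) = bd1 c.
Proof.
pose c' : C1 := repr (chain_class c : Quotient.quot (submod_pred bd2_image)).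
have /quot_piE/asboolP[b bE] : quot_pi bd2_image c' = quot_pi bd2_image c.
  exact: quot_piK.
have := bd1_bd2 b; rewrite bE -[- c]scaleN1r bd1D bd1Z mulN1r => /eqP.
by rewrite subr_eq0 => /eqP.
Qed.

Lemma chain_class_surj v : exists c, v = chain_class c.
Proof.
by exists (repr (v : Quotient.quot (submod_pred bd2_image))); apply/esym/quot_piK.
Qed.

Lemma class_bdZ a v : class_bd (a *: v) = a * class_bd v.
Proof.
by have [c ->] := chain_class_surj v; rewrite -chain_classZ !class_bdE bd1Z.
Qed.
Lemma class_bd_bar g : class_bd (bar1 g) = LGu R g - 1.
Proof. by rewrite class_bdE bd1_single mul1r. Qed.

(** The boundary of the 2-chain [g|h] is g[h] - [gh] + [g]. This crossed product rule is what Fox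
    calculus rests on. *)
Lemma bar1M g h : bar1 (g * h)%g = bar1 g + LGu R g *: bar1 h.
Proof.
rewrite -chain_classZ -fs_singleZ -chain_classD.
apply/esym/quot_piE/asboolP; exists (fs_single (V := C0) (g, h) (1 : LGt)).
rewrite /bd2 fs_lift_single => [|k]; last first.
  by rewrite mul0r !fs_single0 subr0 addr0.
have -> : LGu R g *: (1 : C0) = (1 : LGt) * LGu R g.
  by rewrite -[LHS]/(LGu R g * 1) mulr1 mul1r.
by rewrite [LHS]addrC [LHS]addrA.
Qed.

Lemma LGu1 : LGu R (1%g : G) = 1.
Proof. by apply: LGP => x; rewrite LG1E; exact: lreg1. Qed.

Lemma bar1_1 : bar1 1%g = 0.
Proof.
have := bar1M 1 1; rewrite mulg1 LGu1 scale1r => e.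
by apply: (addIr (bar1 1)); rewrite add0r -e.
Qed.

Lemma bar1V g : bar1 g^-1%g = - (LGu R g^-1%g *: bar1 g).
Proof.
by apply/eqP; rewrite -addr_eq0 -bar1M mulVg bar1_1.
Qed.

Lemma chain_class_sum_bar c :
  exists2 s : seq G, uniq s & chain_class c = \sum_(g <- s) (c g : LGt) *: bar1 g.
Proof.
have [s us cs] := finsupp_enum c; exists s => //.
rewrite {1}(finsupp_decomp us cs) chain_class_sum; apply: eq_bigr => g _.
have e : (c g : LGt) *: (1 : C0) = c g by exact: mulr1.
by rewrite -[in LHS]e fs_singleZ chain_classZ.
Qed.

End ChainsModBoundaries.

(** * Bounding the first Betti number by linear algebra over LG *)

Section BettiBound.
Context (R : realType) (G : groupType).
Local Notation LGt := (LG R G).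
Local Notation bar1 := (@bar1 R G).

Lemma mtr_block (n q : nat) (A : 'M[LGt]_n) (D : 'M[LGt]_q) B C :
  mtr (block_mx A B C D) = mtr A + mtr D.
Proof.
rewrite /mtr big_split_ord /=; congr (_ + _); apply: eq_bigr => i _.
  by rewrite block_mxEul.
by rewrite block_mxEdr.
Qed.

Lemma mtrE n (A : 'M[LGt]_n) : mtr A = complex.Re (\sum_i LGtr (A i i)).
Proof.
rewrite (big_morph (@complex.Re R) (id1 := 0) (op1 := +%R)) //.
by case=> a b [c d].
Qed.

Context (q r : nat) (us : 'I_q -> G) (ts : 'I_r -> G) (t0 : G).

(** In the application [us] lists the generators outside the free set, while [ts] and [t0] make up
    the free set. *)
Definition bar_span (v : C1_mod_bd R G) : Prop := exists x : 'I_q -> LGt, exists y : 'I_r -> LGt,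
  exists z : LGt, v = \sum_j x j *: bar1 (us j) + \sum_i y i *: bar1 (ts i) + z *: bar1 t0.

Lemma bar_span0 : bar_span 0.
Proof.
exists (fun=> 0), (fun=> 0), 0.
by rewrite !big1 ?scale0r ?addr0 // => i _; rewrite scale0r.
Qed.

Lemma bar_spanD v w : bar_span v -> bar_span w -> bar_span (v + w).
Proof.
move=> [x [y [z ->]]] [x' [y' [z' ->]]].
exists (fun j => x j + x' j), (fun i => y i + y' i), (z + z').
rewrite addrACA scalerDl; congr (_ + _); rewrite addrACA.
by congr (_ + _); rewrite -big_split; apply: eq_bigr => i _; rewrite scalerDl.
Qed.

Lemma bar_spanZ a v : bar_span v -> bar_span (a *: v).
Proof.
move=> [x [y [z ->]]]; exists (fun j => a * x j), (fun i => a * y i), (a * z).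
rewrite !scalerDr !scaler_sumr scalerA; congr (_ + _ + _).
  by apply: eq_bigr => j _; rewrite scalerA.
by apply: eq_bigr => j _; rewrite scalerA.
Qed.

Lemma bar_spanN v : bar_span v -> bar_span (- v).
Proof. by rewrite -scaleN1r; exact: bar_spanZ. Qed.

Lemma generates_bar_span (S : {fset G}) : generates S ->
  (forall s, s \in S -> bar_span (bar1 s)) -> forall v, bar_span v.
Proof.
move=> gS hS v.
have hw (w : seq G) : all (fun s => (s \in S) || ((s^-1)%g \in S)) w ->
    bar_span (bar1 (\prod_(s <- w) s)%g).
  elim: w => [_|s w IH /= /andP[sS /IH hw]].
    by rewrite big_nil bar1_1; exact: bar_span0.
  rewrite big_cons bar1M; apply: bar_spanD; last exact: bar_spanZ.
  have [/hS //|/= nS] := boolP (s \in S).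
  rewrite (negPf nS) /= in sS; rewrite -[s]invgK bar1V.
  by apply/bar_spanN/bar_spanZ/hS.
have [c ->] := chain_class_surj v; have [s _ ->] := chain_class_sum_bar c.
elim: s => [|g s IH]; first by rewrite big_nil; exact: bar_span0.
rewrite big_cons; apply: bar_spanD => //; apply: bar_spanZ.
by have [n [w [wS _ ->]]] := gS g; exact: hw.
Qed.

(** If the trace of A exceeded r, some nonzero u in the row space of A would give a cycle with class
    a multiple of [t0] alone; being a cycle, it would be a boundary, against injectivity of f. *)
Lemma LGdim_H1_le (a : 'I_q -> LGt) (b : 'I_q -> 'I_r -> LGt) (b0 : 'I_q -> LGt) :
  (forall v, bar_span v) ->
  (forall j, a j *: bar1 (us j) = \sum_i b j i *: bar1 (ts i) + b0 j *: bar1 t0) ->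
  (forall j c, c * a j = 0 -> c = 0) ->
  (forall y, y * (LGu R t0 - 1) = 0 -> y *: bar1 t0 = 0) ->
  (LGdim (H1_LG R G) <= r%:R%:E)%E.
Proof.
move=> spanP relP a_reg t0P; apply: ge_ereal_sup => _ [n [A [AA [f finj] ->]]].
rewrite -mtrE lee_fin leNgt; apply/negP => trA.
pose z i : cycles1 R G := repr (f (row i A) : Quotient.quot (submod_pred (@boundaries1 R G))).
have zE i : quot_pi (@boundaries1 R G) (z i) = f (row i A) by exact: quot_piK.
have [X hX] := @choice _ _ (fun i x => exists y zz,
   chain_class (cycle1_val (z i)) = \sum_j x j *: bar1 (us j)
     + \sum_j y j *: bar1 (ts j) + zz *: bar1 t0) (fun i => spanP _).
have [Y hY] := @choice _ _ (fun i y => exists zz,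
   chain_class (cycle1_val (z i)) = \sum_j X i j *: bar1 (us j)
     + \sum_j y j *: bar1 (ts j) + zz *: bar1 t0) hX.
have [Z hZ] := choice hY.
(* The unknown is a row (u, c) with u A = u, and the equations are u X = c diag(a) and u Y = - c b:
   q + r of them, against unknowns of trace tr A + q. *)
pose E : 'M[LGt]_(n + q) := block_mx A 0 0 1%:M.
pose N : 'M[LGt]_(n + q, q + r) := block_mx (\matrix_(i, j) X i j) (\matrix_(i, j) Y i j)
  (- \matrix_(i, j) (if i == j then a j else 0)) (\matrix_(i, j) b i j).
have EE : E *m E = E.
  by rewrite /E mulmx_block !mulmx0 !mul0mx !addr0 !add0r AA mul1mx.
have trE : (q + r)%:R < mtr E.
  by rewrite /E mtr_block mtr1 natrD addrC ltrD2r.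
have [v [v0 vE vN]] := idempotent_kernel N EE trE.
have [u [c vuc]] : exists u, exists c, v = row_mx u c.
  by exists (lsubmx v), (rsubmx v); rewrite hsubmxK.
have uA : u *m A = u.
  by move: vE; rewrite vuc /E mul_row_block !mulmx0 addr0 => /eq_row_mx[].
move: vN; rewrite vuc /N mul_row_block mulmxN => h.
have /rowP h1 := congr1 (@lsubmx _ _ _ _) h; have /rowP h2 := congr1 (@rsubmx _ _ _ _) h.
have uX j : \sum_i u 0 i * X i j = c 0 j * a j.
  have := h1 j; rewrite row_mxKl !mxE => /eqP; rewrite subr_eq0 => /eqP e.
  transitivity (\sum_i u 0 i * (\matrix_(i, j) X i j) i j).
    by apply: eq_bigr => i _; rewrite mxE.
  rewrite e (bigD1 j) //= big1 ?addr0 => [|i /negPf ij]; first by rewrite !mxE eqxx.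
  by rewrite !mxE ij mulr0.
have uY j : \sum_i u 0 i * Y i j = - \sum_i c 0 i * b i j.
  have := h2 j; rewrite row_mxKr !mxE => /eqP; rewrite addr_eq0 => /eqP e.
  transitivity (\sum_i u 0 i * (\matrix_(i, j) Y i j) i j).
    by apply: eq_bigr => i _; rewrite mxE.
  by rewrite e; congr (- _); apply: eq_bigr => i _; rewrite mxE.
(* If u vanished, so would each [c 0 j * a j], and c by regularity of the [a j]. *)
have u0 : u != 0.
  apply: contraNneq v0 => u0; rewrite vuc u0.
  suff -> : c = 0 by rewrite row_mx0.
  apply/rowP => j; rewrite mxE; apply: (a_reg j); rewrite -uX u0.
  by rewrite big1 // => i _; rewrite mxE mul0r.
(* The relations trade c a [us] for c b [ts] + c b0 [t0]; the [ts] terms cancel and this coefficient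
   of [t0] is left. *)
pose y := \sum_i u 0 i * Z i + \sum_j c 0 j * b0 j.
have wE : chain_class (\sum_i u 0 i *: cycle1_val (z i)) = y *: bar1 t0.
  rewrite chain_class_sum (eq_bigr (fun i =>
    \sum_j (u 0 i * X i j) *: bar1 (us j) + \sum_j (u 0 i * Y i j) *: bar1 (ts j)
      + (u 0 i * Z i) *: bar1 t0)); last first.
    move=> i _; rewrite chain_classZ hZ !scalerDr !scaler_sumr scalerA.
    by congr (_ + _ + _); apply: eq_bigr => j _; rewrite scalerA.
  rewrite !big_split /= -scaler_suml /y scalerDl [RHS]addrC; congr (_ + _).
  rewrite exchange_big /= (eq_bigr (fun j => (c 0 j * a j) *: bar1 (us j))); last first.
    by move=> j _; rewrite -scaler_suml uX.
  rewrite [X in _ + X]exchange_big /=.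
  under [X in _ + X]eq_bigr do rewrite -scaler_suml uY scaleNr scaler_suml.
  rewrite sumrN exchange_big /= -sumrB scaler_suml; apply: eq_bigr => j _.
  rewrite -[(c 0 j * a j) *: _]scalerA relP scalerDr scaler_sumr.
  rewrite (eq_bigr (fun i => (c 0 j * b j i) *: bar1 (ts i))); last first.
    by move=> i _; rewrite scalerA.
  by rewrite addrAC subrr add0r scalerA.
(* The chain is a cycle, so taking boundaries gives y (t0 - 1) = 0. *)
have w0 : chain_class (\sum_i u 0 i *: cycle1_val (z i)) = 0.
  rewrite wE; apply: t0P; have := congr1 (@class_bd R G) wE.
  rewrite class_bdZ class_bd_bar => <-; rewrite class_bdE.
  rewrite (big_morph (@bd1 R G) (@bd1D R G) (bd1_0 R G)) big1 // => i _.
  by rewrite bd1Z; case: (z i) => c' /= /eqP ->; rewrite mulr0.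
have [B BE] := (chain_classP _).1 w0.
have fu : f (u *m A) = 0.
  rewrite mulmx_sum_row linear_sum /=.
  rewrite (eq_bigr (fun i => quot_pi (@boundaries1 R G) (u 0 i *: z i))); last first.
    by move=> i _; rewrite linearZ /= -zE; exact: quot_piZ.
  have pi0 : quot_pi (@boundaries1 R G) 0 = 0.
    by apply: (addIr (quot_pi (@boundaries1 R G) 0)); rewrite -quot_piD !add0r.
  rewrite -(big_morph (quot_pi (@boundaries1 R G)) (@quot_piD _ _ _) pi0) -pi0.
  apply/quot_piE; rewrite subr0; apply/asboolP; exists B; rewrite BE.
  exact/esym/(big_morph (@cycle1_val R G)).
have := finj u 0; rewrite mul0mx linear0 fu => /(_ erefl); rewrite uA => ue.
by rewrite ue eqxx in u0.
Qed.

End BettiBound.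

(** * Words and Fox calculus *)

Section Words.
Context (G : groupType).
Implicit Types (l : G * bool) (w : seq (G * bool)) (T : {fset G}).

Definition lval l : G := if l.2 then l.1 else (l.1^-1)%g.
Definition linv l : G * bool := (l.1, ~~ l.2).
Definition wval w : G := (\prod_(l <- w) lval l)%g.
Definition reduced w : bool := sorted (fun l l' => l' != linv l) w.
Definition letters_in T w : bool := all (fun l => l.1 \in T) w.

Definition freely_generates T : Prop :=
  forall w, letters_in T w -> reduced w -> wval w = 1%g -> w = [::].

Lemma linvK : involutive linv. Proof. by case=> x b; rewrite /linv negbK. Qed.

Lemma lvalV l : lval (linv l) = (lval l)^-1%g.
Proof. by case: l => x [] //=; rewrite /lval /= invgK. Qed.

Lemma wval_cat w w' : wval (w ++ w') = (wval w * wval w')%g.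
Proof. exact: big_cat. Qed.

Lemma wval_cons l w : wval (l :: w) = (lval l * wval w)%g.
Proof. exact: big_cons. Qed.

Lemma wval1 l : wval [:: l] = lval l. Proof. exact: big_seq1. Qed.

Definition wrev w := rev (map linv w).

Lemma wval_rev w : wval (wrev w) = (wval w)^-1%g.
Proof.
rewrite /wrev; elim: w => [|l w IH]; first by rewrite /wval !big_nil invg1.
by rewrite /= rev_cons -cats1 wval_cat IH wval1 wval_cons invgM lvalV.
Qed.

Lemma reduced_rev w : reduced (wrev w) = reduced w.
Proof.
rewrite /reduced /wrev rev_sorted sorted_map; apply: eq_sorted => l l' /=.
by rewrite linvK eq_sym.
Qed.

Lemma reduced_catl w w' : reduced (w ++ w') -> reduced w.
Proof. by rewrite /reduced => /cat_sorted2[]. Qed.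

Lemma reduced_catr w w' : reduced (w ++ w') -> reduced w'.
Proof. by rewrite /reduced => /cat_sorted2[]. Qed.

(** Strip common first letters; once they differ, the inverse of one word followed by the other is
    reduced, nonempty and trivial in G. *)
Lemma free_wval_inj T w w' : freely_generates T ->
  letters_in T w -> letters_in T w' -> reduced w -> reduced w' ->
  wval w = wval w' -> w = w'.
Proof.
move=> fT; elim: w w' => [|l w IH] [|l' w'] //.
- by move=> _ lw' _ rw' e; apply/esym/fT => //; rewrite -e /wval big_nil.
- by move=> lw _ rw _ e; apply/fT => //; rewrite e /wval big_nil.
move=> lw lw' rw rw' e; have [ll'|ll'] := eqVneq l l'.
  move: e; rewrite -ll' !wval_cons => /mulgI e; congr (_ :: _).
  case/andP: lw lw' => _ lw /andP[_ lw'].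
  by apply: IH => //; [exact: (@reduced_catr [:: l])|exact: (@reduced_catr [:: l'])].
suff : wrev (l :: w) ++ l' :: w' = [::].
  by move/(congr1 size); rewrite size_cat /= addnS.
apply: fT.
- rewrite /letters_in all_cat; apply/andP; split=> //.
  rewrite /wrev all_rev all_map; exact: lw.
- move: rw; rewrite -reduced_rev /wrev map_cons rev_cons /reduced cat_rcons.
  move: rw'; rewrite /reduced /=; case: (rev _) => [|l0 s] /=.
    by move=> ->; rewrite linvK eq_sym ll'.
  rewrite -cats1 !cat_path /= linvK => -> /and3P[-> -> _] /=.
  by rewrite eq_sym ll'.
- by rewrite wval_cat wval_rev e mulVg.
Qed.

(** [(g, b)] stands for the summand [g] if [b], and [- g] otherwise, of the Fox
    derivative with respect to [u] of the word [w], multiplied on the left by [p]. *)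
Fixpoint fox_terms (u p : G) w : seq (G * bool) :=
  if w is l :: w' then
    (if l.1 == u then [:: (if l.2 then p else (p * lval l)%g, l.2)] else [::])
      ++ fox_terms u (p * lval l)%g w'
  else [::].

Lemma mem_fox_terms u p w g b : (g, b) \in fox_terms u p w ->
  exists w1 w2, w = w1 ++ (u, b) :: w2 /\
    g = (p * wval w1 * (if b then 1 else u^-1))%g.
Proof.
elim: w p => // -[x c] w IH p /=; rewrite mem_cat => /orP[|/IH[w1 [w2 [-> ->]]]].
  case: eqP => // ->; rewrite inE => /eqP[-> ->]; exists [::], w; split=> //.
  by rewrite /wval big_nil mulg1; case: c; rewrite ?mulg1.
by exists ((x, c) :: w1), w2; rewrite wval_cons !mulgA.
Qed.

Lemma fox_terms_nil u p w : fox_terms u p w = [::] -> all (fun l => l.1 != u) w.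
Proof. by elim: w p => // l w IH p /=; case: eqP => //= _ /IH. Qed.

Lemma cat_cons_split (A : Type) (w1 w2 w1' w2' : seq A) a b :
  w1 ++ a :: w2 = w1' ++ b :: w2' -> (size w1 < size w1')%N ->
  exists m, w1' = w1 ++ a :: m.
Proof.
elim: w1 w1' => [|x w1 IH] [|y w1'] //=; first by case=> -> _ _; exists w1'.
by case=> -> /IH h /h [m ->]; exists m.
Qed.

(* Two cancelling Fox terms would cut out of [w] a shorter subword with value [1]. *)
Lemma fox_terms_nocancel u p w g T : letters_in T w -> reduced w ->
  (forall w', letters_in T w' -> reduced w' -> wval w' = 1%g ->
     (size w' < size w)%N -> w' = [::]) ->
  (g, true) \in fox_terms u p w -> (g, false) \in fox_terms u p w -> False.
Proof.
move=> lw rw minw /mem_fox_terms[w1 [w2 [e1 g1]]] /mem_fox_terms[w1' [w2' [e2 g2]]].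
(* A trivial subword between opposite occurrences of u is empty by minimality, which leaves two
   adjacent inverse letters in a reduced word. *)
have key b a1 m a2 : w = a1 ++ (u, b) :: m ++ (u, ~~ b) :: a2 -> wval m = 1%g -> False.
  move=> e m1; have m0 : m = [::].
    apply: minw => //.
    - by move: lw; rewrite e /letters_in all_cat /= all_cat => /and4P[].
    - by move: rw; rewrite e => /reduced_catr /(@reduced_catr [:: _]) /reduced_catl.
    - by rewrite e size_cat /= size_cat /= addnS ltnS addnCA leq_addr.
  move: rw; rewrite e m0 => /reduced_catr; rewrite /reduced /= /linv /=.
  by rewrite eqxx.
have := e1; rewrite {1}e2 => e12.
have [lt|lt|eqs] := ltngtP (size w1) (size w1').
- have [m em] := cat_cons_split (esym e12) lt.
  apply: (key true w1 m w2'); first by rewrite e2 em -catA.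
  move: g2; rewrite g1 em wval_cat wval_cons !mulg1 /lval /= -!mulgA.
  move/mulgI; rewrite -[LHS]mulg1 => /mulgI /esym/eqP.
  by rewrite mulgA divg_eq1 -{2}[u]mulg1 => /eqP/mulgI.
- have [m em] := cat_cons_split e12 lt.
  apply: (key false w1' m w2); first by rewrite e1 em -catA.
  move: g1; rewrite g2 em wval_cat wval_cons !mulg1 /lval /= -!mulgA.
  by move=> /mulgI /mulgI; rewrite -[LHS]mulg1 => /mulgI <-.
- by move/eqP: e12; rewrite eqseq_cat // => /andP[_ /eqP[]].
Qed.

Definition signed_sum (L : seq (G * bool)) : ZG G :=
  \sum_(t <- L) fs_single t.1 ((if t.2 then 1 else -1) : int^o).

(** The terms at the group element of the first entry all have its sign, so the coefficient there is
    nonzero. *)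
Lemma signed_sum_neq0 (L : seq (G * bool)) : L != [::] ->
  (forall g, (g, true) \in L -> (g, false) \in L -> False) -> signed_sum L != 0.
Proof.
case: L => // -[g b] L _ h; apply/eqP => /(congr1 (fun c : ZG G => c g)) /=.
rewrite /signed_sum finsupp_sum /= => e.
pose s : int := if b then 1 else -1.
have : s * \sum_(t <- (g, b) :: L)
   (if g == t.1 then (if t.2 then 1 else -1) else 0 : int) > 0.
  rewrite mulr_sumr big_cons /= eqxx ltr_pwDl //; first by rewrite /s; case: (b).
  rewrite big_seq; apply: sumr_ge0 => -[k c] kL /=; case: eqP => [gk|]; last by rewrite mulr0.
  have [->|bc] := eqVneq c b; first by rewrite /s; case: (b).
  exfalso; apply: (h g); case: (b) bc kL; case: c; rewrite // -?gk => _ kL;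
    by rewrite inE ?eqxx ?kL ?orbT.
by rewrite e mulr0 ltxx.
Qed.

End Words.

Section FoxCalculus.
Context (R : realType) (G : groupType).
Local Notation LGt := (LG R G).
Local Notation bar1 := (@bar1 R G).

Lemma zgLG_signed_sum (L : seq (G * bool)) :
  zgLG R (signed_sum L) = \sum_(t <- L) (if t.2 then LGu R t.1 else - LGu R t.1).
Proof.
rewrite /signed_sum (big_morph (@zgLG R G) (@zgLGD R G) (zgLG0 R G)).
by apply: eq_bigr => -[g []] _ /=; rewrite zgLG_single ?mulr1z ?mulrN1z.
Qed.

(** Induction on w by [bar1M]; the prefix p accumulates the letters already read. *)
Lemma fundamental_fox (U : seq G) (p : G) (w : seq (G * bool)) : uniq U ->
  all (fun l => l.1 \in U) w ->
  LGu R p *: bar1 (wval w) = \sum_(u <- U) zgLG R (signed_sum (fox_terms u p w)) *: bar1 u.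
Proof.
move=> uU; elim: w p => [|[x b] w IH] p /=.
  move=> _; rewrite /wval big_nil bar1_1 scaler0 big1 // => u _.
  by rewrite /signed_sum big_nil zgLG0 scale0r.
move=> /andP[xU wU]; rewrite wval_cons bar1M scalerDr scalerA -LGuM IH //.
under [RHS]eq_bigr do rewrite zgLG_signed_sum big_cat /= scalerDl -zgLG_signed_sum.
rewrite big_split /=; congr (_ + _); last first.
  by apply: eq_bigr => u _; rewrite zgLG_signed_sum.
rewrite (bigD1_seq x) //= eqxx ?zgLG_signed_sum big_seq1 /= big1 ?addr0; last first.
  by move=> u /negPf xu; rewrite eq_sym xu ?zgLG_signed_sum big_nil scale0r.
by case: b => //=; rewrite /lval /= bar1V scalerN scalerA -LGuM scaleNr.
Qed.

(** Here a is the Fox derivative with respect to s of a shortest nonempty reduced relation over T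
    and s. *)
Lemma nonfree_relation (T : {fset G}) (s : G) :
  freely_generates T -> ~ freely_generates (s |` T)%fset ->
  exists a : ZG G, a != 0 /\
    exists b : G -> LGt, zgLG R a *: bar1 s = \sum_(t <- T) b t *: bar1 t.
Proof.
move=> fT nf.
pose bad n := `[< exists w, [/\ letters_in (s |` T)%fset w, reduced w, wval w = 1%g,
  w <> [::] & size w = n] >].
have exbad : exists n, bad n.
  apply: contra_notP nf => nb w lw rw w1; apply: contrapT => w0.
  by apply: nb; exists (size w); apply/asboolP; exists w.
have sT : s \notin T.
  by apply/negP => sT; apply: nf; rewrite (fsetUidPr _ _ _) // fsub1set.
case: (ex_minnP exbad) => n /asboolP[w [lw rw w1 w0 sw]] minn.
have minw w' : letters_in (s |` T)%fset w' -> reduced w' -> wval w' = 1%g ->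
    (size w' < size w)%N -> w' = [::].
  move=> lw' rw' w'1 lt; apply: contrapT => w'0.
  have : bad (size w') by apply/asboolP; exists w'.
  by move/minn; rewrite -sw leqNgt lt.
exists (signed_sum (fox_terms s 1 w)); split.
  (* Without a term for s, the relation would involve letters of T only, against freeness of T. *)
  apply: signed_sum_neq0 => [|g]; last exact: (fox_terms_nocancel lw rw minw).
  apply: contra_notN w0 => /eqP/fox_terms_nil ws; apply: fT => //.
  apply/allP => l lw'; have := allP lw l lw'; have := allP ws l lw'.
  by rewrite in_fset1U => /negPf ->.
exists (fun t => - zgLG R (signed_sum (fox_terms t 1 w))).
have uU : uniq (s :: T) by rewrite /= sT fset_uniq.
have := fundamental_fox 1%g uU (w := w); rewrite w1 bar1_1 scaler0.
have -> : all (fun l => l.1 \in s :: T) w.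
  by apply: sub_all lw => l; rewrite in_fset1U inE.
move=> /(_ isT); rewrite big_cons => /esym/eqP; rewrite addr_eq0 => /eqP ->.
by rewrite -sumrN; apply: eq_bigr => t _; rewrite scaleNr.
Qed.

End FoxCalculus.

(** * A maximal free subset of the generators bounds the Betti number *)

Section FreeRank.
Context (R : realType) (G : groupType).
Local Notation LGt := (LG R G).
Local Notation bar1 := (@bar1 R G).

Lemma bar_span_us (q r : nat) (us : 'I_q -> G) (ts : 'I_r -> G) t0 j :
  bar_span (R := R) us ts t0 (bar1 (us j)).
Proof.
exists (fun j' => (j' == j)%:R), (fun=> 0), 0.
rewrite scale0r addr0 [X in _ + X]big1 => [|i _]; last by rewrite scale0r.
rewrite addr0 (bigD1 j) //= eqxx scale1r big1 ?addr0 // => i /negPf ->.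
by rewrite scale0r.
Qed.

Lemma bar_span_ts (q r : nat) (us : 'I_q -> G) (ts : 'I_r -> G) t0 i :
  bar_span (R := R) us ts t0 (bar1 (ts i)).
Proof.
exists (fun=> 0), (fun i' => (i' == i)%:R), 0.
rewrite scale0r addr0 [X in X + _]big1 => [|j _]; last by rewrite scale0r.
rewrite add0r (bigD1 i) //= eqxx scale1r big1 ?addr0 // => j /negPf ->.
by rewrite scale0r.
Qed.

Lemma bar_span_t0 (q r : nat) (us : 'I_q -> G) (ts : 'I_r -> G) t0 :
  bar_span (R := R) us ts t0 (bar1 t0).
Proof.
exists (fun=> 0), (fun=> 0), 1.
by rewrite !big1 ?scale1r ?add0r // => j _; rewrite scale0r.
Qed.

Lemma freely_generates0 : freely_generates (fset0 : {fset G}).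
Proof. by case. Qed.

Lemma max_free_subset (S : {fset G}) : exists T : {fset G},
  [/\ (T `<=` S)%fset, freely_generates T
    & forall s, s \in (S `\` T)%fset -> ~ freely_generates (s |` T)%fset].
Proof.
pose P n := `[< exists T : {fset G},
  [/\ (T `<=` S)%fset, freely_generates T & #|` T|%fset = n] >].
have exP : exists n, P n.
  by exists 0%N; apply/asboolP; exists fset0; split=> //; rewrite ?fsub0set ?cardfs0 //;
    exact: freely_generates0.
have bP n : P n -> (n <= #|` S|%fset)%N.
  by move=> /asboolP[T [TS _ <-]]; exact: fsubset_leq_card.
case: (ex_maxnP exP bP) => n /asboolP[T [TS fT Tn]] maxn.
exists T; split=> // s; rewrite in_fsetD => /andP[sT sS] fsT.
have : P #|` (s |` T)|%fset.
  apply/asboolP; exists (s |` T)%fset; split=> //.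
  by rewrite fsubUset TS fsub1set sS.
by move/maxn; rewrite cardfsU1 sT -Tn add1n ltnn.
Qed.

Lemma LGdim_H1_free_subset (S : {fset G}) :
  (forall a : ZG G, a != 0 -> injective (fun x : l2 R G => ZG_act a x)) ->
  generates S -> exists T : {fset G}, [/\ (T `<=` S)%fset, freely_generates T
    & (LGdim (H1_LG R G) <= (#|` T|%fset.-1)%:R%:E)%E].
Proof.
move=> inj genS; have [T [TS fT Tmax]] := max_free_subset S.
exists T; split=> //.
pose D := (S `\` T)%fset; pose q := size D; pose us (j : 'I_q) := nth 1%g D j.
have usD j : us j \in D by exact: mem_nth.
have relD (j : 'I_q) : exists ab : ZG G * (G -> LGt), ab.1 != 0 /\
    zgLG R ab.1 *: bar1 (us j) = \sum_(t <- T) ab.2 t *: bar1 t.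
  by have [a [a0 [b e]]] := nonfree_relation R fT (Tmax _ (usD j)); exists (a, b).
have [ab abP] := choice relD.
have regD j c : c * zgLG R (ab j).1 = 0 -> c = 0.
  by have [a0 _] := abP j; exact: zgLG_cancelr.
have spanD (r : nat) (ts : 'I_r -> G) t0 :
    (forall t, t \in T -> bar_span (R := R) us ts t0 (bar1 t)) ->
    forall v, bar_span (R := R) us ts t0 v.
  move=> hT; apply: (generates_bar_span genS) => s sS.
  have [sT|sT] := boolP (s \in T); first exact: hT.
  have sD : s \in D by rewrite in_fsetD sT.
  have sq : (index s D < q)%N by rewrite index_mem.
  have -> : s = us (Ordinal sq) by rewrite /us nth_index.
  exact: bar_span_us.
(* For empty T there is no generator to delete; the identity, whose bar is zero, serves as t0,
   matching [0.-1 = 0]. *)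
case eT: (enum_fset T) => [|t0 tl].
  move=> /=.
  have T0 t : t \in T = false by rewrite -[LHS]/(t \in enum_fset T) eT.
  pose ts (i : 'I_0) : G := 1%g.
  apply: (@LGdim_H1_le R G q 0 us ts 1%g (fun j => zgLG R (ab j).1)
    (fun _ _ => 0) (fun=> 0)).
  - by apply: spanD => t; rewrite T0.
  - move=> j; have [_ ->] := abP j.
    by rewrite eT big_nil big_ord0 scale0r addr0.
  - exact: regD.
  - by move=> y _; rewrite bar1_1 scaler0.
move=> /=; pose r := size tl; pose ts (i : 'I_r) := nth 1%g tl i.
have memT t : (t \in T) = (t \in t0 :: tl) by rewrite -[LHS]/(t \in enum_fset T) eT.
have t0T : t0 \in T by rewrite memT mem_head.
apply: (@LGdim_H1_le R G q r us ts t0 (fun j => zgLG R (ab j).1)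
    (fun j i => (ab j).2 (ts i)) (fun j => (ab j).2 t0)).
- apply: spanD => t; rewrite memT inE => /orP[/eqP->|ttl].
    exact: bar_span_t0.
  have tr : (index t tl < r)%N by rewrite index_mem.
  have -> : t = ts (Ordinal tr) by rewrite /ts nth_index.
  exact: bar_span_ts.
- move=> j; have [_ ->] := abP j.
  by rewrite eT big_cons addrC (big_nth 1%g) big_mkord.
- exact: regD.
(* t0 - 1 comes from a group ring element, nonzero because a member of a free set is not the
   identity; so it can be cancelled. *)
- move=> y; have -> : LGu R t0 - 1 = zgLG R (signed_sum [:: (t0, true); (1%g, false)]).
    by rewrite zgLG_signed_sum big_cons big_seq1 /= LGu1.
  move=> y0; rewrite (zgLG_cancelr inj _ y0) ?scale0r //.
  apply: signed_sum_neq0 => // g; rewrite !inE !xpair_eqE !andbT !andbF orbF orFb.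
  move=> /eqP -> /eqP t01.
  suff : [:: (t0, true)] = [::] by [].
  by apply: fT => //; rewrite ?/letters_in /= ?t0T // wval1.
Qed.

End FreeRank.

(** * Counting reduced words in word balls *)

Section GrowthLower.
Context (G : groupType).
Implicit Types (S T : {fset G}).

Lemma word_ball_split S n m g : word_ball S (n + m) g ->
  exists x y, [/\ word_ball S n x, word_ball S m y & g = (x * y)%g].
Proof.
move=> [w [wS wn ->]]; exists (\prod_(s <- take n w) s)%g, (\prod_(s <- drop n w) s)%g.
move: wS; rewrite -{1}(cat_take_drop n w) all_cat => /andP[w1 w2]; split.
- by exists (take n w); split=> //; rewrite size_take; case: ltnP.
- by exists (drop n w); split=> //; rewrite size_drop leq_subLR.
- by rewrite -big_cat cat_take_drop.
Qed.

Lemma word_ball_1 S n : word_ball S n 1%g.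
Proof. by exists [::]; split=> //; rewrite big_nil. Qed.

Lemma word_ball_finite S n : finite_set (word_ball S n).
Proof.
elim: n => [|n IH].
  apply: (sub_finite_set _ (finite_set1 1%g)) => g [w [_ + ->]].
  by rewrite leqn0 => /nilP ->; rewrite big_nil.
pose A := [set` S] `|` (fun g => g^-1%g) @` [set` S] `|` [set 1%g].
have fA : finite_set A.
  by rewrite !finite_setU; split; [split|]; [|apply: finite_image|];
    try exact: finite_fset; exact: finite_set1.
apply: (@sub_finite_set _ _ ((fun p : G * G => (p.1 * p.2)%g) @` (A `*` word_ball S n))).
  rewrite -add1n => g /word_ball_split[x [y [[w [wS w1 ->]] yB ->]]].
  exists ((\prod_(s <- w) s)%g, y) => //; split=> //=.
  case: w w1 wS => [|s [|//]] _ /=; first by rewrite big_nil; right.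
  rewrite big_seq1 andbT => /orP[sS|sS]; left; [by left|right].
  by exists s^-1%g; rewrite ?invgK.
by apply: finite_image; apply: finite_setX.
Qed.

Definition ball_card S n := #|` fset_set (word_ball S n)|%fset.

Lemma mem_ball S n g : (g \in fset_set (word_ball S n)) = `[< word_ball S n g >].
Proof. by rewrite in_fset_set ?inE //; exact: word_ball_finite. Qed.

Lemma ball_card_gt0 S n : (0 < ball_card S n)%N.
Proof.
rewrite cardfs_gt0; apply/fset0Pn; exists 1%g; rewrite mem_ball.
by apply/asboolP; exact: word_ball_1.
Qed.

Lemma ball_cardM S n m : (ball_card S (n + m) <= ball_card S n * ball_card S m)%N.
Proof.
rewrite /ball_card -(size_allpairs (fun x y : G => (x * y)%g)).
apply: uniq_leq_size => [|g]; first exact: fset_uniq.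
rewrite mem_ball => /asboolP /word_ball_split[x [y [xB yB ->]]].
by apply/allpairsP; exists (x, y); split=> //; rewrite mem_ball; apply/asboolP.
Qed.

Definition fset_letters T : seq (G * bool) := [seq (x, b) | x <- T, b <- [:: true; false]].

Fixpoint reduced_words T n : seq (seq (G * bool)) :=
  if n is n'.+1 then
    [seq l :: w | w <- reduced_words T n', l <- [seq l <- fset_letters T | reduced (l :: w)]]
  else [:: [::]].

Lemma mem_reduced_words T n w : w \in reduced_words T n ->
  [/\ letters_in T w, reduced w & size w = n].
Proof.
elim: n w => [|n IH] w /=; first by rewrite inE => /eqP ->.
move=> /allpairsPdep[w' [l [/IH[lw' rw' sw']]]].
rewrite mem_filter => /andP[rl /allpairsP[[x b] /= [xT _ el]]] ->.
by split=> //=; [rewrite el /= xT|rewrite sw'].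
Qed.

Lemma fset_letters_uniq T : uniq (fset_letters T).
Proof. by apply: allpairs_uniq => [|//|[x b] [y c] _ _ [-> ->]//]; exact: fset_uniq. Qed.

Lemma reduced_words_uniq T n : uniq (reduced_words T n).
Proof.
elim: n => //= n IH; apply: allpairs_uniq_dep => //.
- by move=> w _; rewrite filter_uniq // fset_letters_uniq.
- by move=> [w l] [w' l'] _ _ /= [-> ->].
Qed.

(** Of the 2 #T letters, at most one, the inverse of the first letter, cannot be prepended to a
    reduced word; this leaves at least 2 #T - 1 extensions. *)
Lemma size_reduced_words T n : (0 < #|` T|%fset)%N ->
  (((#|` T|%fset.-1).*2.+1) ^ n <= size (reduced_words T n))%N.
Proof.
move=> T0; elim: n => //= n IH; rewrite size_allpairs_dep expnSr.
apply: (@leq_trans (\sum_(w <- reduced_words T n) (#|` T|%fset.-1).*2.+1)).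
  by rewrite big_const_seq count_predT iter_addn_0 [leqRHS]mulnC leq_mul2r IH orbT.
rewrite sumnE big_map big_seq [leqRHS]big_seq; apply: leq_sum => w wT.
have [_ rw _] := mem_reduced_words wT.
rewrite size_filter.
have sz : size (fset_letters T) = (#|` T|%fset.-1).*2.+2.
  by rewrite /fset_letters size_allpairs /= muln2 -{1}(prednK T0) doubleS.
case: w rw {wT} => [_|l' w rw].
  by rewrite (eq_count (a2 := predT)) ?count_predT ?sz.
have ct : (count (fun l => ~~ reduced [:: l, l' & w]) (fset_letters T) <= 1)%N.
  rewrite (eq_count (a2 := pred1 (linv l'))) => [|l /=].
    by rewrite count_uniq_mem ?fset_letters_uniq // leq_b1.
  move: rw; rewrite /reduced /= => ->; rewrite andbT negbK.
  by rewrite -(inj_eq (inv_inj (@linvK G))) linvK eq_sym.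
have := count_predC (fun l => reduced [:: l, l' & w]) (fset_letters T).
by rewrite sz => e; rewrite -ltnS -e -[X in (_ <= X)%N]addn1 leq_add2l.
Qed.

(** Freeness makes evaluation injective on reduced words. For empty T the base is 1, and the ball
    contains the identity. *)
Lemma free_ball_card S T n : (T `<=` S)%fset -> freely_generates T ->
  (((#|` T|%fset.-1).*2.+1) ^ n <= ball_card S n)%N.
Proof.
move=> TS fT; have [T0|T0] := posnP #|` T|%fset.
  by rewrite T0 exp1n ball_card_gt0.
apply: leq_trans (size_reduced_words n T0) _.
rewrite -(size_map (@wval G)); apply: uniq_leq_size.
  rewrite map_inj_in_uniq ?reduced_words_uniq // => w w' wT w'T.
  have [lw rw _] := mem_reduced_words wT; have [lw' rw' _] := mem_reduced_words w'T.
  exact: free_wval_inj fT lw lw' rw rw'.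
move=> g /mapP[w wT ->]; rewrite mem_ball; apply/asboolP.
have [lw _ sw] := mem_reduced_words wT.
exists (map (@lval G) w); split.
- rewrite all_map; apply: sub_all lw => -[x []] /= /(fsubsetP TS) xS; first by rewrite xS.
  by rewrite /lval /= invgK xS orbT.
- by rewrite size_map sw.
- by rewrite big_map.
Qed.

End GrowthLower.

(** * Growth *)

(** The limit is the infimum of u(m)/m: writing n = q m + r bounds u(n)/n by u(m)/m plus a bounded
    remainder divided by n. *)
Lemma fekete (R : realType) (u : nat -> R) : (forall n, 0 <= u n) ->
  (forall n m, u (n + m)%N <= u n + u m) -> cvgn (fun n => u n / n%:R).
Proof.
move=> u0 uD.
pose A := [set x | exists2 m, (0 < m)%N & x = u m / m%:R].
have A0 : has_inf A.
  split; first by exists (u 1%N / 1%:R), 1%N.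
  by exists 0 => _ [m _ ->]; rewrite divr_ge0.
have uM q m r : u (q * m + r)%N <= q%:R * u m + u r.
  elim: q => [|q IH]; first by rewrite mul0n mul0r add0r.
  rewrite mulSn -addnA; apply: le_trans (uD _ _) _.
  by rewrite -addn1 natrD mulrDl mul1r addrAC [leRHS]addrC lerD2l.
apply/cvg_ex; exists (inf A); apply/cvgrPdist_le => e e0.
have e2 : 0 < e / 2 by rewrite divr_gt0.
have [_ [m m0 ->] hm] := inf_adherent e2 A0.
(* A bound for u(r) for all remainders r < m, from u(r) <= r u(1) + u(0). *)
pose M := m%:R * u 1%N + u 0%N.
have M0 : 0 <= M by rewrite addr_ge0 ?mulr_ge0.
have uMle r : (r < m)%N -> u r <= M.
  move=> rm; have := uM r 1%N 0%N; rewrite muln1 addn0 => /le_trans; apply.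
  by rewrite lerD2r ler_wpM2r // ler_nat ltnW.
pose N := (Num.truncn (M / (e / 2))).+1.
exists N => // n /= Nn.
have n0 : (0 < n)%N by apply: leq_trans Nn.
have nR : 0 < n%:R :> R by rewrite ltr0n.
have mR : 0 < m%:R :> R by rewrite ltr0n.
have lb : inf A <= u n / n%:R by apply: ge_inf; [exact: A0.2|exists n].
have Mn : M / n%:R <= e / 2.
  rewrite ler_pdivrMr // mulrC -ler_pdivrMr //.
  apply: (@le_trans _ _ N%:R); last by rewrite ler_nat.
  by rewrite ltW // truncnS_gt.
have ub : u n / n%:R <= u m / m%:R + M / n%:R.
  rewrite ler_pdivrMr // mulrDl divfK ?gt_eqF //.
  rewrite {1}(divn_eq n m); apply: le_trans (uM _ _ _) _.
  apply: lerD; last by apply: uMle; rewrite ltn_mod.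
  rewrite mulrAC -mulrA mulrC ler_wpM2l // ler_pdivlMr // -natrM ler_nat.
  exact: leq_trunc_div.
by rewrite ler0_norm ?subr_le0 // opprB; lra.
Qed.

Section GrowthRate.
Context (R : realType) (G : groupType) (S : {fset G}).

(** [limn] carries information only for convergent sequences. Ball sizes are submultiplicative, so
    Fekete applies to their logarithms. *)
Lemma growth_cvg : cvgn (fun n => ((ball_card S n)%:R : R) `^ (n%:R^-1)).
Proof.
have b0 n : 0 < (ball_card S n)%:R :> R by rewrite ltr0n ball_card_gt0.
have cu : cvgn (fun n => ln ((ball_card S n)%:R : R) / n%:R).
  apply: fekete => [n|n m].
    by rewrite ln_ge0 // ler1n ball_card_gt0.
  rewrite -lnM ?posrE // ler_ln ?posrE ?mulr_gt0 // -natrM ler_nat.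
  exact: ball_cardM.
apply/cvg_ex; exists (expR (limn (fun n => ln ((ball_card S n)%:R : R) / n%:R))).
rewrite (_ : (fun n => _) = expR \o (fun n => ln ((ball_card S n)%:R : R) / n%:R)).
  apply: continuous_cvg => //; exact: continuous_expR.
by apply/funext => n; rewrite /= /powR gt_eqF // mulrC.
Qed.

Lemma growth_rate_ge (k : nat) :
  (forall n, (k ^ n <= ball_card S n)%N) -> k%:R <= growth_rate R S.
Proof.
move=> hk; apply: limr_ge; first exact: growth_cvg.
(* At n = 0 the exponent [n%:R^-1] is 0 and the root is 1, so the comparison starts at n = 1. *)
exists 1%N => // n /= n0.
have nR : n%:R != 0 :> R by rewrite pnatr_eq0 -lt0n.
have -> : k%:R = (k%:R ^+ n) `^ (n%:R^-1) :> R.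
  by rewrite -powR_mulrn ?ler0n // -powRrM mulfV // powRr1 // ler0n.
apply: ge0_ler_powR; rewrite ?invr_ge0 ?ler0n ?nnegrE ?exprn_ge0 ?ler0n //.
by rewrite -natrX ler_nat.
Qed.

End GrowthRate.

Theorem corollary4p8 (R : realType) (G : groupType)
    (Gcountable : countable [set: G])
    (Gfg : finitely_generated G)
    (Gtf : torsion_free G)
    (ZGinj : forall a : ZG G, a != 0 -> injective (fun x : l2 R G => ZG_act a x))
    (S : {fset G}) (Sgen : generates S) :
  (2%:E * ceile (l2betti1 R G) + 1 <= (growth_rate R S)%:E)%E.
Proof.
have [T [TS fT betti_le]] := LGdim_H1_free_subset ZGinj Sgen.
set r := (#|` T|%fset.-1) in betti_le.
have growth_ge : r.*2.+1%:R <= growth_rate R S.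
  by apply: growth_rate_ge => n; exact: free_ball_card.
rewrite -/(l2betti1 R G) in betti_le.
case: (l2betti1 R G) betti_le => [x| |] //= xr.
- rewrite lee_fin in xr; apply: le_trans (_ : (r.*2.+1%:R%:E <= _)%E).
    have -> : r.*2.+1%:R = 2 * r%:R + 1 :> R by rewrite -addn1 natrD -muln2 natrM mulrC.
    rewrite -EFinM -EFinD lee_fin lerD2r ler_pM2l //.
    (* The upper bound r is an integer, so it also bounds the ceiling. *)
    by rewrite -[r%:R]/(r%:Z%:~R) ler_int ceil_le_int.
  by rewrite lee_fin.
- by rewrite mulrNy gtr0_sg // mul1e addNye leNye.
Qed.
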